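(* There exists a Banach lattice of density character $\mathfrak{c}$ (the cardinality of the continuum) that is of universal disposition for the class of all separable Banach lattices.
   Context: Banach lattices are real. An embedding is an isometric lattice embedding: a linear, norm-preserving map commuting with the lattice operations. For a class $\mathcal{C}$ of Banach lattices, a Banach lattice $X$ is of universal disposition for $\mathcal{C}$ if for all embeddings $f:R\to S$ and $g:R\to X$ of Banach lattices with $S\in\mathcal{C}$, there exists an embedding $h:S\to X$ with $h\circ f=g$. The density character of a space is the least cardinality of a dense subset. *)

(* Defs.v *)
From HB Require Import structures.
From mathcomp Require Import all_boot all_order all_algebra.
From mathcomp Require Import all_classical all_reals all_analysis.

Set Implicit Arguments.
Unset Strict Implicit.
Unset Printing Implicit Defensive.

Import Order.TTheory GRing.Theory Num.Theory.
Import numFieldNormedType.Exports.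

Local Open Scope card_scope.
Local Open Scope classical_set_scope.
Local Open Scope ring_scope.

(* Vector lattices carry their own order and lattice operations: a common
   extension of GRing.Lmodule and Order.Lattice cannot be declared in the
   hierarchy, as their join there is Num.RealDomain.  vlexI and vleUx are the
   axioms lexI and leUx of Order.Lattice. *)
HB.mixin Record Lmodule_isVectorLattice (R : realType) E
    of GRing.Lmodule R E := {
  vle : rel E ;
  vmeet : E -> E -> E ;
  vjoin : E -> E -> E ;
  vle_refl : reflexive vle ;
  vle_anti : antisymmetric vle ;
  vle_trans : transitive vle ;
  vlexI : forall x y z : E, vle x (vmeet y z) = vle x y && vle x z ;
  vleUx : forall x y z : E, vle (vjoin x y) z = vle x z && vle y z ;
  vleD2r : forall z x y : E, vle x y -> vle (x + z) (y + z) ;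
  vscale_ge0 : forall (a : R) (x : E), 0 <= a -> vle 0 x -> vle 0 (a *: x) }.

#[short(type="vectorLatticeType")]
HB.structure Definition VectorLattice (R : realType) :=
  { E of GRing.Lmodule R E & Lmodule_isVectorLattice R E }.

(* Not to be confused with the norm, for which the library writes `|x|. *)
Definition modulus (R : realType) (E : vectorLatticeType R) (x : E) : E :=
  vjoin x (- x).

HB.mixin Record NormedModule_isBanachLattice (R : realType) E
    of CompleteNormedModule R E & VectorLattice R E := {
  blat_norm_le : forall x y : E, vle (modulus x) (modulus y) -> `|x| <= `|y| }.

#[short(type="banachLatticeType")]
HB.structure Definition BanachLattice (R : realType) :=
  { E of CompleteNormedModule R E & VectorLattice R E
       & NormedModule_isBanachLattice R E }.

Record lattice_embedding (R : realType) (E F : banachLatticeType R)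
    (f : E -> F) : Prop := LatticeEmbedding {
  embedding_linear : linear f ;
  embedding_norm : forall x, `|f x| = `|x| ;
  embedding_meet : {morph f : x y / vmeet x y} ;
  embedding_join : {morph f : x y / vjoin x y} }.

Definition universal_disposition (R : realType)
    (C : banachLatticeType R -> Prop) (X : banachLatticeType R) : Prop :=
  forall (E S : banachLatticeType R) (f : E -> S) (g : E -> X),
    C S -> lattice_embedding f -> lattice_embedding g ->
    exists2 h : S -> X, lattice_embedding h & h \o f = g.

Definition separable (T : topologicalType) : Prop :=
  exists2 D : set T, dense D & countable D.

(* A cardinal is represented by any set K having it. *)
Definition has_density_character (T : topologicalType) (U : Type) (K : set U)
    : Prop :=
  (exists2 D : set T, dense D & D #= K) /\
  (forall D : set T, dense D -> K #<= D).

(* Main.v *)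
(* Every inequality between vector lattice terms that holds in R holds in all
   vector lattices, so a separable Banach lattice with a dense sequence amounts
   to a solid seminorm on terms over nat.  The universal lattice is presented
   by generators and relations on terms: its generators are organized in
   well-founded trees ("keys") with countable branching, a node asking for an
   extension, with prescribed seminorm, of the sublattice spanned by countably
   many earlier generators.  The norm of u is the least cost of a combination of
   relations dominating |u|.

   Amalgamation is isometric by interpolation: when a(x) + b(y) is bounded by a
   multiple of |c(x) - c'(y)|, a term w in the common variables fits in between,
   a(x) <= w(c(x)) and w(c'(y)) <= -b(y) up to a small error.  Used from the top
   of the trees downwards, this discards from a combination of relations the
   nodes that do not occur in u, and shows that a node which extends an
   isometric copy is an isometric copy itself.  The countable branching makes
   the quotient complete, and gives it no more than continuum many points. *)
Require Import Defs.
From HB Require Import structures.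
From mathcomp Require Import all_boot all_order all_algebra.
From mathcomp Require Import all_classical all_reals all_analysis.
From mathcomp Require Import ring lra.

Set Implicit Arguments.
Unset Strict Implicit.
Unset Printing Implicit Defensive.

Import Order.TTheory GRing.Theory Num.Theory.
Import numFieldNormedType.Exports.

Local Open Scope card_scope.
Local Open Scope classical_set_scope.
Local Open Scope ring_scope.

(** * Vector lattices *)

(** All extensions are asked for at once, by the well-founded type of keys, so there is no
    transfinite recursion and no bookkeeping of stages. The price is that some keys ask for
    nonsense: a node whose seminorm is smaller than the norm its glued points already have would
    shrink that norm. Hence only hereditarily [good] nodes serve as generators. To avoid
    circularity, goodness of a node refers only to relations of strictly smaller keys; that the norm
    computed with all good nodes is the same is then a theorem, the conservativity of good nodes.
    The space is not completed afterwards: a completion would contain points that are not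
    generators, to which no node could be glued. Instead, a Cauchy sequence is itself a request for
    an extension, by its limit, of the sublattice spanned by its countably many variables. Thus
    every point of the quotient is the class of a single generator, and a node can be glued to any
    sequence of points. *)

Section VectorLatticeTheory.
Variables (R : realType) (E : vectorLatticeType R).
Implicit Types x y z : E.

Lemma vle_le_trans x y z : vle x y -> vle y z -> vle x z.
Proof. exact: vle_trans. Qed.

Lemma vle_joinl x y : vle x (vjoin x y).
Proof. by have := vle_refl (vjoin x y); rewrite vleUx => /andP[]. Qed.

Lemma vle_joinr x y : vle y (vjoin x y).
Proof. by have := vle_refl (vjoin x y); rewrite vleUx => /andP[]. Qed.

Lemma vle_meetl x y : vle (vmeet x y) x.
Proof. by have := vle_refl (vmeet x y); rewrite vlexI => /andP[]. Qed.

Lemma vle_meetr x y : vle (vmeet x y) y.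
Proof. by have := vle_refl (vmeet x y); rewrite vlexI => /andP[]. Qed.

Lemma veqP x y : vle x y -> vle y x -> x = y.
Proof. by move=> xy yx; apply: vle_anti; rewrite xy yx. Qed.

Lemma vjoinP x y j : vle x j -> vle y j ->
  (forall z, vle x z -> vle y z -> vle j z) -> j = vjoin x y.
Proof.
move=> xj yj jP; apply: veqP; last by rewrite vleUx xj yj.
by apply: jP; [exact: vle_joinl|exact: vle_joinr].
Qed.

Lemma vmeetP x y m : vle m x -> vle m y ->
  (forall z, vle z x -> vle z y -> vle z m) -> m = vmeet x y.
Proof.
move=> mx my mP; apply: veqP; first by rewrite vlexI mx my.
by apply: mP; [exact: vle_meetl|exact: vle_meetr].
Qed.

Lemma vleD2rE z x y : vle (x + z) (y + z) = vle x y.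
Proof.
apply/idP/idP; last exact: vleD2r.
by move/(vleD2r (- z)); rewrite !addrK.
Qed.

Lemma vleBlDr x y z : vle (x - z) y = vle x (y + z).
Proof. by rewrite -(vleD2rE z) subrK. Qed.

Lemma vleBrDr x y z : vle x (y - z) = vle (x + z) y.
Proof. by rewrite -(vleD2rE z) subrK. Qed.

Lemma vleN2 x y : vle (- x) (- y) = vle y x.
Proof. by rewrite -(vleD2rE (x + y)) addrA addNr add0r addrCA addNr addr0. Qed.

Lemma vleD x y z t : vle x y -> vle z t -> vle (x + z) (y + t).
Proof.
move=> xy zt; apply: (@vle_le_trans _ (y + z)); first by rewrite vleD2rE.
by rewrite ![y + _]addrC vleD2rE.
Qed.

Lemma vleZ (a : R) x y : 0 <= a -> vle x y -> vle (a *: x) (a *: y).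
Proof.
move=> a0 xy; have := @vscale_ge0 _ _ a (y - x) a0.
rewrite vleBrDr add0r => /(_ xy); by rewrite scalerBr vleBrDr add0r.
Qed.

Lemma vjoinD x y z : vjoin x y + z = vjoin (x + z) (y + z).
Proof.
apply: vjoinP; rewrite ?vleD2rE ?vle_joinl ?vle_joinr// => t.
by rewrite -!vleBrDr vleUx => -> ->.
Qed.

Lemma vmeetD x y z : vmeet x y + z = vmeet (x + z) (y + z).
Proof.
apply: vmeetP; rewrite ?vleD2rE ?vle_meetl ?vle_meetr// => t.
by rewrite -!vleBlDr vlexI => -> ->.
Qed.

Lemma vjoinN x y : - vjoin x y = vmeet (- x) (- y).
Proof.
apply: vmeetP; rewrite ?vleN2 ?vle_joinl ?vle_joinr// => t.
by rewrite -{1 2}[t]opprK !vleN2 -{3}[t]opprK vleN2 vleUx => -> ->.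
Qed.

Lemma vmeetN x y : - vmeet x y = vjoin (- x) (- y).
Proof. by rewrite -[vjoin _ _]opprK vjoinN !opprK. Qed.

Lemma vjoinZ (a : R) x y : 0 < a -> a *: vjoin x y = vjoin (a *: x) (a *: y).
Proof.
move=> a0; apply: vjoinP; rewrite ?vleZ ?ltW ?vle_joinl ?vle_joinr// => t xt yt.
have a'0 : 0 <= a^-1 by rewrite invr_ge0 ltW.
rewrite -[t](scalerK (lt0r_neq0 a0)) scalerA mulrC -scalerA.
apply: vleZ; first exact: ltW.
rewrite vleUx -{1}[x](scalerK (lt0r_neq0 a0)) -{1}[y](scalerK (lt0r_neq0 a0)).
by rewrite !vleZ.
Qed.

Lemma vmeetZ (a : R) x y : 0 < a -> a *: vmeet x y = vmeet (a *: x) (a *: y).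
Proof.
move=> a0; rewrite -[LHS]opprK -scalerN vmeetN vjoinZ// vjoinN.
by rewrite !scalerN !opprK.
Qed.

Lemma vjoinC x y : vjoin x y = vjoin y x.
Proof.
by apply: veqP; rewrite vleUx vle_joinl vle_joinr.
Qed.

Lemma vjoin_meet x y : vjoin x y = x + y - vmeet x y.
Proof.
rewrite vmeetN addrC vjoinD addrA addNr add0r addrC -addrA subrr addr0.
exact: vjoinC.
Qed.

Lemma vle_meetW x y z : vle y z -> vle (vmeet x y) (vmeet x z).
Proof.
by move=> yz; rewrite vlexI vle_meetl (vle_le_trans (vle_meetr _ _) yz).
Qed.

(** Distributivity is not an axiom; it follows from translation invariance through
    [vjoin x y = x + y - vmeet x y], which trades an upper bound by a join for one on a translated
    meet. *)
Lemma vjoin_meetr x y z :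
  vjoin x (vmeet y z) = vmeet (vjoin x y) (vjoin x z).
Proof.
apply: vmeetP => [||m].
- by rewrite vleUx vle_joinl (vle_le_trans (vle_meetl _ _) (vle_joinr _ _)).
- by rewrite vleUx vle_joinl (vle_le_trans (vle_meetr _ _) (vle_joinr _ _)).
have H t : vle m (vjoin x t) -> vle (vmeet y z) t ->
    vle (m + vmeet x (vmeet y z) - x) t.
  rewrite vjoin_meet vleBrDr vleBlDr => mt yzt; rewrite [t + x]addrC.
  by apply: vle_trans mt; rewrite ![m + _]addrC vleD2rE vle_meetW.
move=> my mz; rewrite vjoin_meet vleBrDr [x + _]addrC -vleBlDr vlexI.
by rewrite !H// ?vle_meetl ?vle_meetr.
Qed.

End VectorLatticeTheory.
(** * Linear inequalities *)

Section Farkas.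
Variable R : realType.

Lemma continuous_sum (T : topologicalType) (I : Type) (r : seq I)
    (f : I -> T -> R) :
  (forall i, continuous (f i)) -> continuous (fun x => \sum_(i <- r) f i x).
Proof.
move=> fc x; elim: r => [|i r IHr].
  by under eq_fun do rewrite big_nil; exact: cvg_cst.
by under eq_fun do rewrite big_cons; exact: (cvgD (fc _ _) IHr).
Qed.

(* Gordan's alternative, by taking the point of least norm in the convex hull
   of the [l j]. *)
Lemma gordan (m n : nat) (l : 'I_m.+1 -> 'I_n -> R) :
  (forall x : 'I_n -> R, exists j, 0 <= \sum_k l j k * x k) ->
  exists c : 'I_m.+1 -> R, [/\ forall j, 0 <= c j, \sum_j c j = 1 &
    forall k, \sum_j c j * l j k = 0].
Proof.
move=> lP.
pose v (c : 'rV[R]_m.+1) k := \sum_j c ord0 j * l j k.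
pose f c := \sum_k v c k * v c k.
pose D := [set c : 'rV[R]_m.+1 | forall j, c ord0 j \in `[0, 1]%R].
pose P := [set c : 'rV[R]_m.+1 | \sum_j c ord0 j = 1].
have cv k : continuous (fun c => v c k).
  rewrite /v; apply: (@continuous_sum _ _ _ (fun j (c : 'rV[R]_m.+1) => c ord0 j
    * l j k)) => j c.
  exact: (cvgM (@coord_continuous _ _ _ _ _ c) (cvg_cst _)).
have cf : continuous f.
  by apply: (@continuous_sum _ _ _ (fun k c => v c k * v c k)) => k c;
    exact: (cvgM (cv k c) (cv k c)).
have cD : compact (D `&` P).
  apply: compact_closedI.
    have := @rV_compact R _ (fun _ : 'I_m.+1 => `[0, 1]%classic).
    by apply => _; exact: segment_compact.
  apply: (@preimage_closed _ _ (fun c : 'rV[R]_m.+1 => \sum_j c ord0 j)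
    [set x | x = 1]); last exact: closed_eq.
  by move=> c _; apply: (@continuous_sum _ _ _ (fun j (c : 'rV[R]_m.+1) => c
    ord0 j)) => j; exact: coord_continuous.
have [||c /set_mem[cD' cP] cmin] := @EVT_min_rV _ _ f _ _ cD.
- exists (\row_j (j == ord0)%:R); split.
    by move=> j; rewrite mxE in_itv /=; case: (j == ord0); rewrite lexx ler01.
  rewrite /P/= (bigD1 ord0)//= mxE eqxx big1 ?addr0// => j /negbTE j0.
  by rewrite mxE j0.
- exact: continuous_subspaceT.
have c0 j : 0 <= c ord0 j by have := cD' j; rewrite in_itv /= => /andP[].
have c1 j : c ord0 j <= 1 by have := cD' j; rewrite in_itv /= => /andP[].
(* First-order condition at the minimum: moving [c] slightly towards the vertex [j] must not
   decrease the squared norm [f]. *)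
have dP j : f c <= \sum_k l j k * v c k.
  rewrite leNgt; apply/negP => lt.
  pose a := f c - \sum_k l j k * v c k.
  pose b := \sum_k (l j k - v c k) ^+ 2.
  have a0 : 0 < a by rewrite subr_gt0.
  have b0 : 0 <= b by apply: sumr_ge0 => k _; exact: sqr_ge0.
  have H (t : R) : 0 < t -> t <= 1 -> 2 * t * a <= t ^+ 2 * b.
    move=> t0 t1.
    have := cmin (\row_i ((1 - t) * c ord0 i + t * (i == j)%:R)).
    have vE k : v (\row_i ((1 - t) * c ord0 i + t * (i == j)%:R)) k =
        v c k + t * (l j k - v c k).
      rewrite /v; under eq_bigr => i _ do rewrite mxE mulrDl -!mulrA.
      rewrite big_split/= -!mulr_sumr.
      have -> : \sum_i (i == j)%:R * l i k = l j k.
        rewrite (bigD1 j)//= eqxx mul1r big1 ?addr0// => i /negbTE->.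
        by rewrite mul0r.
      by rewrite /v; ring.
    have -> : f (\row_i ((1 - t) * c ord0 i + t * (i == j)%:R)) =
        f c - 2 * t * a + t ^+ 2 * b.
      rewrite /f; under eq_bigr => k _ do rewrite vE.
      rewrite /a /b /f -sumrB !mulr_sumr -sumrB -big_split/=.
      by apply: eq_bigr => k _; move: (v c k) (l j k) => x y; ring.
    rewrite inE => /(_ _)/wrap[]; last by lra.
    split.
      move=> i; rewrite mxE in_itv/=; have := c0 i; have := c1 i.
      by case: (i == j) => /= ? ?; nra.
    rewrite /P/=; under eq_bigr => i _ do rewrite mxE.
    rewrite big_split/= -!mulr_sumr cP (bigD1 j)//= eqxx big1 ?addr0.
      by rewrite !mulr1 subrK.
    by move=> i /negbTE->.
  (* For this step length [t * b < 2 * a], against [H]; the [+ 1] covers [b = 0]. *)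
  have t0 : 0 < Num.min 1 (a / (b + 1)).
    by rewrite lt_min ltr01 divr_gt0//; lra.
  have := H _ t0; rewrite ge_min lexx/= => /(_ isT).
  set t := Num.min _ _ in t0 *.
  have : t * (b + 1) <= a.
    by rewrite -ler_pdivlMr ?ge_min ?lexx ?orbT//; lra.
  move=> ? ?.
  have : t * (2 * a) <= t * (t * b) by nra.
  by rewrite ler_pM2l//; nra.
have fc0 : f c = 0.
  (* At [- v c] the hypothesis yields a form that is nonpositive at [v c], and [dP] bounds the
     squared norm by its value there. *)
  have [j] := lP (fun k => - v c k).
  under eq_bigr do rewrite mulrN; rewrite sumrN oppr_ge0 => ?.
  apply/le_anti; rewrite (le_trans (dP j))//=.
  by apply: sumr_ge0 => k _; rewrite -expr2 sqr_ge0.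
exists (fun j => c ord0 j); split => // k.
have /eqP := fc0; rewrite psumr_eq0 => [|i _]; last by rewrite -expr2 sqr_ge0.
by move/allP => /(_ k (mem_index_enum _)); rewrite mulf_eq0 orbb => /eqP.
Qed.

End Farkas.
(** * Vector lattice terms *)

Inductive term (R A : Type) : Type :=
| tvar of A
| tzero
| tadd of term R A & term R A
| tscale of R & term R A
| tjoin of term R A & term R A.
Arguments tvar {R A}.
Arguments tzero {R A}.

Section Terms.
Variable R : realType.

Fixpoint val A (x : A -> R) (u : term R A) : R :=
  match u with
  | tvar a => x a
  | tzero => 0
  | tadd u v => val x u + val x v
  | tscale r u => r * val x u
  | tjoin u v => Num.max (val x u) (val x v)
  end.

Fixpoint eval (E : vectorLatticeType R) A (s : A -> E) (u : term R A) : E :=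
  match u with
  | tvar a => s a
  | tzero => 0
  | tadd u v => eval s u + eval s v
  | tscale r u => r *: eval s u
  | tjoin u v => vjoin (eval s u) (eval s v)
  end.

Fixpoint tbind A B (f : A -> term R B) (u : term R A) : term R B :=
  match u with
  | tvar a => f a
  | tzero => tzero
  | tadd u v => tadd (tbind f u) (tbind f v)
  | tscale r u => tscale r (tbind f u)
  | tjoin u v => tjoin (tbind f u) (tbind f v)
  end.

Definition tmap A B (f : A -> B) : term R A -> term R B := tbind (tvar \o f).

Definition topp A (u : term R A) := tscale (-1) u.
Definition tsub A (u v : term R A) := tadd u (topp v).
Definition tabs A (u : term R A) := tjoin u (topp u).
Definition tmeet A (u v : term R A) := topp (tjoin (topp u) (topp v)).

Fixpoint tsum A n (f : nat -> term R A) : term R A :=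
  if n is m.+1 then tadd (tsum m f) (f m) else tzero.

Definition tle A (u v : term R A) := forall x, val x u <= val x v.

Lemma val_tbind A B (f : A -> term R B) x u :
  val x (tbind f u) = val (fun a => val x (f a)) u.
Proof. by elim: u => //= [u -> v ->|r u ->|u -> v ->]. Qed.

Lemma val_tmap A B (f : A -> B) x u : val x (tmap f u) = val (x \o f) u.
Proof. exact: val_tbind. Qed.

Lemma val_topp A (x : A -> R) u : val x (topp u) = - val x u.
Proof. by rewrite /= mulN1r. Qed.

Lemma val_tsub A (x : A -> R) u v : val x (tsub u v) = val x u - val x v.
Proof. by rewrite /= mulN1r. Qed.

Lemma val_tabs A (x : A -> R) u : val x (tabs u) = `|val x u|.
Proof. by rewrite /= mulN1r maxrN. Qed.

Lemma val_tmeet A (x : A -> R) u v :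
  val x (tmeet u v) = Num.min (val x u) (val x v).
Proof. by rewrite /= !mulN1r oppr_max !opprK. Qed.

Lemma val_tsum A (x : A -> R) n f :
  val x (tsum n f) = \sum_(k < n) val x (f k).
Proof. by elim: n => [|n IHn] /=; rewrite ?big_ord0// big_ord_recr/= IHn. Qed.

Definition valE := (val_tsub, val_topp, val_tabs, val_tmeet, val_tsum,
  val_tbind, val_tmap).

Lemma val_scale A (x : A -> R) (c : R) u : 0 <= c ->
  val (fun a => c * x a) u = c * val x u.
Proof.
move=> c0; elim: u => //= [|u -> v ->|r u ->|u -> v ->].
- by rewrite mulr0.
- by rewrite mulrDr.
- by rewrite mulrCA.
- by rewrite maxr_pMr.
Qed.

Lemma tbind_tmap A B C (f : B -> term R C) (g : A -> B) u :
  tbind f (tmap g u) = tbind (f \o g) u.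
Proof.
by rewrite /tmap; elim: u => //= [u -> v ->|r u ->|u -> v ->].
Qed.

Lemma tmap_comp A B C (f : B -> C) (g : A -> B) u :
  tmap f (tmap g u) = tmap (f \o g) u.
Proof. exact: tbind_tmap. Qed.

(** * Transfer of inequalities from the reals to vector lattices *)

Section Soundness.
Variables (E : vectorLatticeType R) (s : nat -> E) (n : nat).

Let linR (c : {ffun 'I_n -> R}) (x : nat -> R) := \sum_k c k * x k.
Let linE (c : {ffun 'I_n -> R}) := \sum_k c k *: s k.

(* Pairs of a function and a vector obtained by the same formula, a meet of
   joins of linear forms in the first [n] variables. *)
Inductive join_of_lin : ((nat -> R) -> R) -> E -> Prop :=
| jlin c : join_of_lin (linR c) (linE c)
| jjoin h e h' e' : join_of_lin h e -> join_of_lin h' e' ->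
    join_of_lin (fun x => Num.max (h x) (h' x)) (vjoin e e').

Inductive meet_of_join : ((nat -> R) -> R) -> E -> Prop :=
| mjoin h e : join_of_lin h e -> meet_of_join h e
| mmeet h e h' e' : meet_of_join h e -> meet_of_join h' e' ->
    meet_of_join (fun x => Num.min (h x) (h' x)) (vmeet e e').

Lemma jlinE c h e : linR c =1 h -> linE c = e -> join_of_lin h e.
Proof. by move=> /funext <- <-; exact: jlin. Qed.

Lemma jjoinE h e h' e' k f : join_of_lin h e -> join_of_lin h' e' ->
  (forall x, Num.max (h x) (h' x) = k x) -> vjoin e e' = f -> join_of_lin k f.
Proof. by move=> ? ? /funext <- <-; exact: jjoin. Qed.

Lemma mmeetE h e h' e' k f : meet_of_join h e -> meet_of_join h' e' ->
  (forall x, Num.min (h x) (h' x) = k x) -> vmeet e e' = f -> meet_of_join k f.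
Proof. by move=> ? ? /funext <- <-; exact: mmeet. Qed.

Lemma linRD (c c' : {ffun 'I_n -> R}) x : linR [ffun k => c k + c' k] x = linR c
  x + linR c' x.
Proof.
by rewrite /linR -big_split/=; apply: eq_bigr => k _; rewrite ffunE mulrDl.
Qed.

Lemma linED (c c' : {ffun 'I_n -> R}) : linE [ffun k => c k + c' k] = linE c +
  linE c'.
Proof.
by rewrite /linE -big_split/=; apply: eq_bigr => k _; rewrite ffunE scalerDl.
Qed.

Lemma linRZ a (c : {ffun 'I_n -> R}) x : linR [ffun k => a * c k] x = a * linR c
  x.
Proof.
by rewrite /linR mulr_sumr; apply: eq_bigr => k _; rewrite ffunE mulrA.
Qed.

Lemma linEZ a (c : {ffun 'I_n -> R}) : linE [ffun k => a * c k] = a *: linE c.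
Proof.
by rewrite /linE scaler_sumr; apply: eq_bigr => k _; rewrite ffunE scalerA.
Qed.

Lemma join_of_linD h e h' e' : join_of_lin h e -> join_of_lin h' e' ->
  join_of_lin (fun x => h x + h' x) (e + e').
Proof.
move=> he he'; elim: he => {h e} [c|h1 e1 h2 e2 _ IH1 _ IH2]; last first.
  apply: jjoinE IH1 IH2 _ _ => [x|]; first by rewrite addr_maxl.
  by rewrite vjoinD.
elim: he' => {h' e'} [c'|h1 e1 h2 e2 _ IH1 _ IH2].
  by apply: (@jlinE [ffun k => c k + c' k]) => [x|]; rewrite ?linRD ?linED.
apply: jjoinE IH1 IH2 _ _ => [x|]; first by rewrite addr_maxr.
by rewrite ![linE c + _]addrC vjoinD.
Qed.

Lemma meet_of_joinD h e h' e' : meet_of_join h e -> meet_of_join h' e' ->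
  meet_of_join (fun x => h x + h' x) (e + e').
Proof.
move=> he he'; elim: he => {h e} [h e he|h1 e1 h2 e2 _ IH1 _ IH2]; last first.
  apply: mmeetE IH1 IH2 _ _ => [x|]; first by rewrite addr_minl.
  by rewrite vmeetD.
elim: he' => {h' e'} [h' e' he'|h1 e1 h2 e2 _ IH1 _ IH2].
  by apply: mjoin; exact: join_of_linD.
apply: mmeetE IH1 IH2 _ _ => [x|]; first by rewrite addr_minr.
by rewrite ![e + _]addrC vmeetD.
Qed.

Lemma meet_of_joinU h e h' e' : meet_of_join h e -> meet_of_join h' e' ->
  meet_of_join (fun x => Num.max (h x) (h' x)) (vjoin e e').
Proof.
move=> he he'; elim: he => {h e} [h e he|h1 e1 h2 e2 _ IH1 _ IH2]; last first.
  apply: mmeetE IH1 IH2 _ _ => [x|]; first by rewrite max_minl.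
  by rewrite ![vjoin _ e']vjoinC vjoin_meetr.
elim: he' => {h' e'} [h' e' he'|h1 e1 h2 e2 _ IH1 _ IH2].
  by apply: mjoin; exact: jjoin.
apply: mmeetE IH1 IH2 _ _ => [x|]; first by rewrite max_minr.
by rewrite vjoin_meetr.
Qed.

Lemma join_of_linZ a h e : 0 < a -> join_of_lin h e ->
  join_of_lin (fun x => a * h x) (a *: e).
Proof.
move=> a0; elim => {h e} [c|h1 e1 h2 e2 _ IH1 _ IH2].
  by apply: (@jlinE [ffun k => a * c k]) => [x|]; rewrite ?linRZ ?linEZ.
apply: jjoinE IH1 IH2 _ _ => [x|]; first by rewrite maxr_pMr ?ltW.
by rewrite vjoinZ.
Qed.

Lemma meet_of_joinZ a h e : 0 < a -> meet_of_join h e ->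
  meet_of_join (fun x => a * h x) (a *: e).
Proof.
move=> a0; elim => {h e} [h e he|h1 e1 h2 e2 _ IH1 _ IH2].
  by apply: mjoin; exact: join_of_linZ.
apply: mmeetE IH1 IH2 _ _ => [x|]; first by rewrite minr_pMr ?ltW.
by rewrite vmeetZ.
Qed.

Lemma join_of_linN h e : join_of_lin h e -> meet_of_join (fun x => - h x) (- e).
Proof.
elim => {h e} [c|h1 e1 h2 e2 _ IH1 _ IH2].
  apply: mjoin; apply: (@jlinE [ffun k => -1 * c k]) => [x|].
    by rewrite linRZ mulN1r.
  by rewrite linEZ scaleN1r.
apply: mmeetE IH1 IH2 _ _ => [x|]; first by rewrite oppr_max.
by rewrite vjoinN.
Qed.

Lemma meet_of_joinN h e :
  meet_of_join h e -> meet_of_join (fun x => - h x) (- e).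
Proof.
elim => {h e} [h e he|h1 e1 h2 e2 _ IH1 _ IH2]; first exact: join_of_linN.
have := meet_of_joinU IH1 IH2; rewrite -vmeetN.
by under eq_fun do rewrite -oppr_min.
Qed.

Lemma meet_of_join0 : meet_of_join (fun=> 0) 0.
Proof.
apply: mjoin; apply: (@jlinE [ffun=> 0]) => [x|].
  by rewrite /linR big1// => k _; rewrite ffunE mul0r.
by rewrite /linE big1// => k _; rewrite ffunE scale0r.
Qed.

Lemma join_of_lin_seq h e : join_of_lin h e ->
  exists ls : seq {ffun 'I_n -> R}, (forall x, exists2 l, l \in ls & h x <= linR
    l x) /\
    forall l, l \in ls -> vle (linE l) e.
Proof.
elim => {h e} [c|h1 e1 h2 e2 _ [ls1 [H1 H1']] _ [ls2 [H2 H2']]].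
  exists [:: c]; split=> [x|l]; first by exists c; rewrite ?mem_head.
  by rewrite inE => /eqP ->; exact: vle_refl.
exists (ls1 ++ ls2); split=> [x|l].
  case: (leP (h1 x) (h2 x)) => _.
    by have [l ll ?] := H2 x; exists l => //; rewrite mem_cat ll orbT.
  by have [l ll ?] := H1 x; exists l => //; rewrite mem_cat ll.
rewrite mem_cat => /orP[/H1'|/H2'] /vle_le_trans; apply.
  exact: vle_joinl.
exact: vle_joinr.
Qed.

(** If the maximum of the forms is nowhere negative, Gordan's alternative gives a convex combination
    of them that vanishes. The same combination of vectors is 0, and it lies below [e] because each
    of its members does. *)
Lemma join_of_lin_ge0 h e : join_of_lin h e -> (forall x, 0 <= h x) -> vle 0 e.
Proof.
move=> /join_of_lin_seq[ls [H1 H2]] h0.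
case: ls => [|l0 ls] in H1 H2 *; first by have [] := H1 (fun=> 0).
pose l (j : 'I_(size ls).+1) : 'I_n -> R := nth l0 (l0 :: ls) j.
have [x|c [c0 c1 cl]] := @gordan R (size ls) n l.
  have [l1 l1s hl] := H1 (fun k => oapp x 0 (insub k)).
  have jl : (index l1 (l0 :: ls) < (size ls).+1)%N by rewrite index_mem.
  exists (Ordinal jl); rewrite /l nth_index//;
    apply: le_trans (h0 _) (le_trans hl _).
  by rewrite /linR le_eqVlt; apply/orP; left; apply/eqP/eq_bigr => k _;
    rewrite valK.
have -> : 0 = \sum_j c j *: linE (nth l0 (l0 :: ls) j).
  rewrite /linE; under eq_bigr do rewrite scaler_sumr.
  rewrite exchange_big/= big1// => k _.
  under eq_bigr do rewrite scalerA.
  by rewrite -scaler_suml cl scale0r.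
have -> : e = \sum_j c j *: e by rewrite -scaler_suml c1 scale1r.
elim/big_ind2: _ => [|x1 x2 y1 y2|j _]; first exact: vle_refl.
  exact: vleD.
by apply: vleZ => //; apply: H2; rewrite mem_nth.
Qed.

Lemma meet_of_join_ge0 h e : meet_of_join h e -> (forall x, 0 <= h x) -> vle 0
  e.
Proof.
elim => {h e} [h e|h1 e1 h2 e2 _ IH1 _ IH2 h0]; first exact: join_of_lin_ge0.
rewrite vlexI IH1 ?IH2// => x; have := h0 x; by rewrite le_min => /andP[].
Qed.

End Soundness.

Fixpoint tvar_bound (u : term R nat) : nat :=
  match u with
  | tvar k => k.+1
  | tzero => 0
  | tadd u v => maxn (tvar_bound u) (tvar_bound v)
  | tscale _ u => tvar_bound u
  | tjoin u v => maxn (tvar_bound u) (tvar_bound v)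
  end.

Lemma meet_of_join_term (E : vectorLatticeType R) (s : nat -> E) n u :
  (tvar_bound u <= n)%N -> meet_of_join s n (fun x => val x u) (eval s u).
Proof.
elim: u => [k|//|u IHu v IHv|r u IHu|u IHu v IHv] /=.
- move=> kn; apply: mjoin;
    apply: (@jlinE _ _ _ [ffun j => (j == Ordinal kn)%:R]).
    move=> x; rewrite (bigD1 (Ordinal kn))//= ffunE eqxx mul1r big1 ?addr0//.
    by move=> j /negbTE jk; rewrite ffunE jk mul0r.
  rewrite (bigD1 (Ordinal kn))//= ffunE eqxx scale1r big1 ?addr0//.
  by move=> j /negbTE jk; rewrite ffunE jk scale0r.
- by move=> _; exact: meet_of_join0.
- by rewrite geq_max => /andP[/IHu ? /IHv]; exact: meet_of_joinD.
- move=> /IHu H; case: (ltgtP r 0) => [r0|r0|->].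
  + have := meet_of_joinN (meet_of_joinZ _ H); move=> /(_ (- r)).
    rewrite oppr_gt0 scaleNr opprK => /(_ r0).
    by under eq_fun do rewrite mulNr opprK.
  + exact: meet_of_joinZ.
  + rewrite scale0r; under eq_fun do rewrite mul0r; exact: meet_of_join0.
- by rewrite geq_max => /andP[/IHu ? /IHv]; exact: meet_of_joinU.
Qed.

(** The difference of the terms has a normal form as a meet of joins of linear forms, for which
    positivity passes from functions to vectors. No representation of [E] by functions is
    involved. *)
Lemma tle_eval (E : vectorLatticeType R) (s : nat -> E) u v :
  tle u v -> vle (eval s u) (eval s v).
Proof.
move=> uv; have := meet_of_join_ge0 (meet_of_join_term s (leqnn (tvar_bound
  (tsub v u)))).
rewrite /= scaleN1r vleBrDr add0r; apply => x.
by rewrite mulN1r subr_ge0.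
Qed.

End Terms.
(** * Solid seminorms on terms *)

Lemma distr_max (R : realDomainType) (a b c d : R) :
  `|Num.max a b - Num.max c d| <= `|a - c| + `|b - d|.
Proof.
have := ler_norm (a - c); have := ler_norm (c - a); have := normr_ge0 (a - c).
have := ler_norm (b - d); have := ler_norm (d - b); have := normr_ge0 (b - d).
rewrite [`|d - b|]distrC [`|c - a|]distrC ler_norml.
by case: (leP a b) => ?; case: (leP c d) => ?; lra.
Qed.

Section SolidSeminorm.
Variable R : realType.

Record solid A (p : term R A -> R) : Prop := Solid {
  solidD : forall u v, p (tadd u v) <= p u + p v ;
  solidZ_le : forall r u, p (tscale r u) <= `|r| * p u ;
  solid_le : forall u v, tle (tabs u) (tabs v) -> p u <= p v }.

Section Theory.
Variables (A : Type) (p : term R A -> R) (sp : solid p).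
Implicit Types u v w : term R A.

Lemma solid_abs_le u v : (forall x, `|val x u| <= val x v) -> p u <= p v.
Proof.
move=> uv; apply: (solid_le sp) => x; rewrite !val_tabs.
exact: le_trans (uv x) (ler_norm _).
Qed.

Lemma solid_eq u v : (forall x, val x u = val x v) -> p u = p v.
Proof.
by move=> uv; apply/le_anti; rewrite !(solid_le sp)// => x;
  rewrite !val_tabs uv.
Qed.

Lemma solid_ge0 u : 0 <= p u.
Proof.
have p0 : p tzero <= 0.
  have -> : p tzero = p (tscale 0 u) by apply: solid_eq => x /=; rewrite mul0r.
  by rewrite (le_trans (solidZ_le sp _ _))// normr0 mul0r.
have p0' : 0 <= p tzero.
  have := solidD sp tzero tzero.
  have -> : p (tadd tzero tzero) = p tzero.
    by apply: solid_eq => x /=; rewrite addr0.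
  by rewrite lerDl.
apply: le_trans p0' _; apply: (solid_le sp) => x.
by rewrite !val_tabs /= normr0.
Qed.

Lemma solid0 : p tzero = 0.
Proof.
apply/le_anti; rewrite solid_ge0 andbT.
rewrite (_ : p tzero = p (tscale 0 tzero)); last first.
  by apply: solid_eq => x /=; rewrite mul0r.
by rewrite (le_trans (solidZ_le sp _ _))// normr0 mul0r.
Qed.

Lemma solidZ r u : p (tscale r u) = `|r| * p u.
Proof.
apply/le_anti; rewrite (solidZ_le sp)/=; have [->|r0] := eqVneq r 0.
  by rewrite normr0 mul0r solid_ge0.
rewrite -ler_pdivlMl ?normr_gt0// -normfV.
apply: le_trans (solidZ_le sp _ _); rewrite le_eqVlt; apply/orP; left;
  apply/eqP.
by apply: solid_eq => x /=; rewrite mulKf.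
Qed.

Lemma solid_tabs u : p (tabs u) = p u.
Proof.
by apply/le_anti; rewrite !(solid_le sp)// => x; rewrite !val_tabs ?normr_id.
Qed.

Lemma solid_tsubC u v : p (tsub u v) = p (tsub v u).
Proof.
by apply/le_anti; rewrite !(solid_le sp)// => x; rewrite !valE distrC.
Qed.

Lemma solid_tsub_trans w u v : p (tsub u v) <= p (tsub u w) + p (tsub w v).
Proof.
apply: le_trans (solidD sp _ _); apply: (solid_le sp) => x.
by rewrite !valE /= !mulN1r addrA subrK.
Qed.

Lemma solid_tsub_le u v : p u <= p v + p (tsub u v).
Proof.
apply: le_trans (solidD sp _ _); apply: (solid_le sp) => x.
by rewrite !valE /= mulN1r addrCA subrr addr0.
Qed.

Lemma solid_sub_le u v : `|p u - p v| <= p (tsub u v).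
Proof.
rewrite ler_distlC lerBlDr [p u + _]addrC -lerBlDl.
have := solid_tsub_le u v; have := solid_tsub_le v u; rewrite solid_tsubC; lra.
Qed.

Lemma solid_tsum n f : p (tsum n f) <= \sum_(k < n) p (f k).
Proof.
elim: n => [|n IHn] /=; first by rewrite solid0 big_ord0.
by rewrite big_ord_recr/=; apply: le_trans (solidD sp _ _) _; rewrite lerD2r.
Qed.

Lemma solid_tscale2 r u u' :
  p (tsub (tscale r u) (tscale r u')) = `|r| * p (tsub u u').
Proof. by rewrite -solidZ; apply: solid_eq => x /=; ring. Qed.

End Theory.

Lemma val_lipschitz (b : term R nat) : exists C : R, exists n, 0 <= C /\
  forall x y, `|val x b - val y b| <= C * \sum_(k < n) `|x k - y k|.
Proof.
have mono (m n : nat) (f : nat -> R) : (forall k, 0 <= f k) -> (m <= n)%N ->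
    \sum_(k < m) f k <= \sum_(k < n) f k.
  move=> f0 mn; rewrite (big_ord_widen n)// big_mkcond/=.
  by apply: ler_sum => k _; case: ifP.
have two (u v : term R nat) :
    (exists C : R, exists n, 0 <= C /\
      forall x y, `|val x u - val y u| <= C * \sum_(k < n) `|x k - y k|) ->
    (exists C : R, exists n, 0 <= C /\
      forall x y, `|val x v - val y v| <= C * \sum_(k < n) `|x k - y k|) ->
    exists C : R, exists n, 0 <= C /\
      forall x y, `|val x u - val y u| + `|val x v - val y v| <=
        C * \sum_(k < n) `|x k - y k|.
  move=> [C [n [C0 Cn]]] [C' [n' [C'0 Cn']]].
  exists (C + C'), (maxn n n'); split; first exact: addr_ge0.
  move=> x y; rewrite mulrDl; apply: lerD.
    apply: le_trans (Cn _ _) _; apply: ler_wpM2l => //.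
    by apply: (mono _ _ (fun k => `|x k - y k|)) => //; rewrite leq_maxl.
  apply: le_trans (Cn' _ _) _; apply: ler_wpM2l => //.
  by apply: (mono _ _ (fun k => `|x k - y k|)) => //; rewrite leq_maxr.
elim: b => [k||u /two IHu v /IHu[C [n [C0 Cn]]]|r u [C [n [C0 Cn]]]
    |u /two IHu v /IHu[C [n [C0 Cn]]]] /=.
- exists 1, k.+1; split=> // x y; rewrite mul1r big_ord_recr/= lerDr.
  by apply: sumr_ge0 => j _.
- by exists 0, 0%N; split=> // x y; rewrite subrr normr0 mul0r.
- exists C, n; split=> // x y; apply: le_trans (Cn x y).
  by rewrite opprD addrACA ler_normD.
- exists (`|r| * C), n; split=> [|x y]; first exact: mulr_ge0.
  by rewrite -mulrBr normrM -mulrA ler_wpM2l.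
- exists C, n; split=> // x y; apply: le_trans (Cn x y).
  exact: distr_max.
Qed.

(** The constants come from the term alone, through its Lipschitz bound on the reals, so that one
    estimate serves all solid seminorms at once. *)
Lemma solid_tbind2 (b : term R nat) : exists C : R, exists n, 0 <= C /\
  forall A (p : term R A -> R) (f g : nat -> term R A), solid p ->
    p (tsub (tbind f b) (tbind g b)) <= C * \sum_(k < n) p (tsub (f k) (g k)).
Proof.
have [C [n [C0 Cn]]] := val_lipschitz b; exists C, n; split=> // A p f g sp.
pose t := tscale C (tsum n (fun k => tabs (tsub (f k) (g k)))).
apply: (@le_trans _ _ (p t)).
  apply: solid_abs_le => // x; rewrite !valE /t /= valE.
  by under eq_bigr do rewrite !valE; exact: Cn.
rewrite solidZ// ger0_norm// ler_wpM2l// (le_trans (solid_tsum sp _ _))//.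
by apply: ler_sum => k _; rewrite solid_tabs.
Qed.

End SolidSeminorm.

(** * Interpolation *)

Section Interpolation.
Variable R : realType.

Lemma segment_net (d : R) : 0 < d -> exists G : seq R,
  forall z, `|z| <= 1 -> exists2 g, g \in G & `|z - g| <= d.
Proof.
move=> d0; pose m := (Num.truncn d^-1).+1.
have m0 : 0 < m%:R :> R by rewrite ltr0n.
have md : m%:R^-1 <= d.
  rewrite -[leRHS]invrK lef_pV2 ?posrE ?invr_gt0//.
  by apply/ltW; exact: truncnS_gt.
exists [seq j%:R / m%:R - 1 | j <- iota 0 (2 * m).+1] => z.
rewrite ler_norml => /andP[z1 z2].
have mz : 0 <= m%:R * (z + 1) by apply: mulr_ge0; [exact: ltW|lra].
have /andP[t1 t2] := truncn_itv mz; set j := Num.truncn _ in t1 t2.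
exists (j%:R / m%:R - 1).
  apply/mapP; exists j => //; rewrite mem_iota/= add0n ltnS -(ler_nat R).
  by rewrite (le_trans t1)// natrM mulrC ler_wpM2r ?(ltW m0)//; lra.
have -> : z - (j%:R / m%:R - 1) = m%:R^-1 * (m%:R * (z + 1) - j%:R).
  by field; rewrite gt_eqF.
rewrite normrM ger0_norm ?invr_ge0 ?(ltW m0)// ger0_norm ?subr_ge0//.
apply: (le_trans _ md); rewrite ger_pMr ?invr_gt0//.
by rewrite lerBlDl natr1 ltW.
Qed.

Lemma cube_net n (d : R) : 0 < d -> exists G : seq (nat -> R), forall z,
  (forall k, (k < n)%N -> `|z k| <= 1) ->
  exists2 g, List.In g G & \sum_(k < n) `|z k - g k| <= d.
Proof.
elim: n d => [|n IHn] d d0.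
  by exists [:: fun=> 0] => z _; exists (fun=> 0); [left|rewrite big_ord0 ltW].
have d20 : 0 < d / 2 by rewrite divr_gt0.
have [G GP] := IHn _ d20; have [H HP] := segment_net d20.
exists (flatten [seq [seq (fun k => if k == n then h else g k) | h <- H] | g <-
  G]).
move=> z z1; have [k kn|g Gg zg] := GP z; first by rewrite z1// ltnW.
have [h Hh zh] := HP (z n) (z1 _ (ltnSn n)).
exists (fun k => if k == n then h else g k).
  apply/List.in_concat;
    exists [seq (fun k => if k == n then h else g k) | h <- H].
  split; first by apply/List.in_map_iff; exists g.
  apply/List.in_map_iff; exists h; split=> //.
  by elim: (H) Hh => //= a l IH; rewrite inE => /orP[/eqP->|/IH]; [left|right].
rewrite big_ord_recr/= eqxx [leRHS]splitr lerD//.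
by rewrite (eq_bigr (fun k : 'I_n => `|z k - g k|)) // => k _; rewrite ltn_eqF.
Qed.

Lemma val_tmeets A (x : A -> R) (d : term R A) (l : seq (term R A)) t :
  t <= val x (foldr (@tmeet R A) d l) <->
  t <= val x d /\ forall u, List.In u l -> t <= val x u.
Proof.
elim: l => [|u l IH]; first by split=> [|[]].
rewrite [foldr _ _ _]/= val_tmeet le_min; split.
  by move=> /andP[tu /IH[td H]]; split=> // v [<-//|]; exact: H.
move=> [td H]; rewrite H ?(IH.2 _)//; last by left.
by split=> // v lv; apply: H; right.
Qed.

(* [w] approximates from above the pos. homogeneous [n]-Lipschitz function
   [z |-> inf_y (B y + n * |y o c - z|_1)] by the minimum, over a net of points
   [u], of the piecewise linear majorants that touch it at [u]. *)
Lemma interpolation A (B : term R A) (c : nat -> A) n (e : R) : 0 < e ->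
  (forall y, 0 <= val y B) -> exists w : term R nat,
  [/\ forall z, 0 <= val z w,
      forall (z : nat -> R) t, (forall y, t <= val y B + n%:R * \sum_(k < n) `|y
        (c k) - z k|) ->
        t <= val z w &
      forall y, val (y \o c) w <= val y B + e * \sum_(k < n) `|y (c k)|].
Proof.
move=> e0 B0.
pose F (z : nat -> R) y := val y B + n%:R * \sum_(k < n) `|y (c k) - z k|.
pose W z := inf [set F z y | y in setT].
have F0 z y : 0 <= F z y by rewrite addr_ge0// mulr_ge0// sumr_ge0.
have Wle z y : W z <= F z y.
  by apply: ge_inf; [exists 0 => _ [y' _ <-]; exact: F0|exists y].
have leW z t : (forall y, t <= F z y) -> t <= W z.
  move=> H; apply: lb_le_inf; first by exists (F z (fun=> 0)), (fun=> 0).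
  by move=> _ [y _ <-]; exact: H.
pose N : term R nat := tsum n (fun k => tabs (tvar k)).
pose h u := tadd (tscale (W u) N)
  (tscale n%:R (tsum n (fun k => tabs (tsub (tvar k) (tscale (u k) N))))).
have NE z : val z N = \sum_(k < n) `|z k|.
  by rewrite valE; apply: eq_bigr => k _; rewrite val_tabs.
have hE u z : val z (h u) = W u * val z N +
    n%:R * \sum_(k < n) `|z k - u k * val z N|.
  rewrite /= valE; congr (_ + _ * _); apply: eq_bigr => k _.
  by rewrite val_tabs val_tsub.
have N0 z : 0 <= val z N by rewrite NE sumr_ge0.
(* By homogeneity, testing [s * W u] at [y] means testing [F] at [s * y]; the second summand of
   [h u] pays for the distance from [z] to [s * u]. *)
have hle u z t : (forall y, t <= F z y) -> t <= val z (h u).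
  move=> tF; rewrite hE -lerBlDr; set s := val z N; set r := n%:R * _.
  have H y : t - r <= s * F u y.
    rewrite lerBlDr; apply: le_trans (tF (fun a => s * y a)) _.
    rewrite /F (val_scale _ _ (N0 z)) -/s mulrDr -addrA lerD2l mulrCA -mulrDr.
    rewrite ler_wpM2l// mulr_sumr -big_split/=; apply: ler_sum => k _.
    have -> : s * `|y (c k) - u k| = `|s * (y (c k) - u k)|.
      by rewrite normrM ger0_norm ?N0.
    rewrite (_ : s * y (c k) - z k = s * (y (c k) - u k) - (z k - u k * s)).
      exact: ler_normB.
    by ring.
  have [s0|s0] := eqVneq s 0.
    by have := H (fun=> 0); rewrite s0 mul0r mulr0.
  have sgt0 : 0 < s by rewrite lt0r s0 N0.
  by rewrite mulrC -ler_pdivrMl//; apply: leW => y; rewrite ler_pdivrMl.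
(* The mesh [d] enters twice with factor [n], in the bound on [W u] and in the second summand of
   [h u]; the [+ 1] covers [n = 0]. *)
pose d := e / (2 * n%:R + 1).
have n0 : 0 <= n%:R :> R by [].
have d0 : 0 < d by rewrite divr_gt0//; lra.
have dE : 2 * n%:R * d <= e.
  rewrite /d mulrA ler_pdivrMr; last by lra.
  by rewrite mulrC ler_pM2l//; lra.
have [G GP] := @cube_net n d d0.
exists (foldr (@tmeet R nat) (h (fun=> 0)) [seq h u | u <- G]).
have leP z t : (forall y, t <= F z y) ->
    t <= val z (foldr (@tmeet R nat) (h (fun=> 0)) [seq h u | u <- G]).
  move=> H; apply/val_tmeets; split; first exact: hle.
  by move=> _ /List.in_map_iff[u [<- _]]; exact: hle.
split=> [z|//|y]; first exact: leP.
set z := y \o c; set s := \sum_(k < n) _.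
have sN : val z N = s by rewrite NE.
have /val_tmeets[H1 H2] := lexx (val z (foldr (@tmeet R nat) (h (fun=> 0))
  [seq h u | u <- G])).
have s0 : 0 <= s by rewrite -sN.
(* A null [z] cannot be normalized into the cube; there the default element of the meet vanishes. *)
have [s_eq0|s_neq0] := eqVneq s 0.
  apply: le_trans H1 _; rewrite hE sN s_eq0 mulr0 add0r.
  rewrite (_ : \sum_(k < n) _ = s) ?s_eq0 ?mulr0 ?addr0//.
  by rewrite -[RHS]s_eq0; apply: eq_bigr => k _; rewrite subr0.
have sgt0 : 0 < s by rewrite lt0r s_neq0.
have [k kn|u Gu uP] := GP (fun k => s^-1 * z k).
  rewrite normrM gtr0_norm ?invr_gt0// ler_pdivrMl// mulr1 /s.
  by rewrite (bigD1 (Ordinal kn))//= lerDl sumr_ge0.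
have /H2 : List.In (h u) [seq h u | u <- G] by apply/List.in_map_iff; exists u.
move=> /le_trans; apply; rewrite hE sN.
have uP' : \sum_(k < n) `|z k - u k * s| <= d * s.
  rewrite mulrC -ler_pdivrMl// mulr_sumr.
  apply: le_trans uP; rewrite le_eqVlt; apply/orP; left; apply/eqP.
  apply: eq_bigr => k _; rewrite -[s^-1 in LHS]gtr0_norm ?invr_gt0// -normrM.
  by congr `|_|; field.
have : W u * s <= val y B + n%:R * (d * s).
  rewrite -ler_pdivlMr//; apply: le_trans (Wle u (fun a => s^-1 * y a)) _.
  rewrite /F val_scale ?invr_ge0// mulrDl mulrC lerD2l mulrA mulfK//.
  by rewrite ler_wpM2l.
have : n%:R * \sum_(k < n) `|z k - u k * s| <= n%:R * (d * s) by rewrite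
  ler_wpM2l.
have : 2 * n%:R * d * s <= e * s by rewrite ler_wpM2r.
lra.
Qed.

End Interpolation.
(** * Generators and relations *)

Record seminorm (R : realType) := Seminorm {
  seminorm_fun :> term R nat -> R ;
  seminorm_solid : solid seminorm_fun }.

(* [node p g i] adjoins a copy of the Banach lattice with dense sequence
   [(s_j)_j] and [|| b(s) || = p b]; its point [s_j] is the pair
   [(node p g i, j)], and [s_{2k}] is to be identified with the earlier point
   [(g k, i k)]. *)
Inductive key (R : realType) : Type :=
| leaf of R
| node of seminorm R & (nat -> key R) & (nat -> nat).

Section Certificates.
Variable R : realType.
Implicit Types (N M : key R) (D : key R -> Prop) (u v d : term R (key R * nat)).
Implicit Types (p : seminorm R) (g : nat -> key R) (i : nat -> nat).

Fixpoint subkey_eq N M : Prop :=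
  M = N \/ if N is node p g i then exists k, subkey_eq (g k) M else False.

Definition subkey N M : Prop :=
  if N is node p g i then exists k, subkey_eq (g k) M else False.

Definition down_closed D := forall N M, D N -> subkey_eq N M -> D M.

Lemma subkey_eqE N M : subkey_eq N M <-> M = N \/ subkey N M.
Proof. by case: N. Qed.

Lemma subkey_eq_refl N : subkey_eq N N.
Proof. by apply/subkey_eqE; left. Qed.

Lemma subkey_eq_trans N M L : subkey_eq N M -> subkey_eq M L -> subkey_eq N L.
Proof.
elim: N => [r|p g IH i] /=; first by case=> // ->.
by case=> [->//|[k kM] ML]; right; exists k; exact: IH kM ML.
Qed.

Lemma subkey_trans N M L : subkey N M -> subkey_eq M L -> subkey N L.
Proof. case: N => //= p g i [k kM] ML; exists k;
  exact: subkey_eq_trans kM ML. Qed.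

Lemma subkey_child p g i k : subkey (node p g i) (g k).
Proof. by exists k; exact: subkey_eq_refl. Qed.

Lemma subkey_irrefl N : ~ subkey N N.
Proof.
elim: N => [r|p g IH i] /=; first by [].
case=> k /subkey_eqE[E|H]; apply: (IH k).
  by rewrite -{1}E; exact: subkey_child.
by apply: subkey_trans H _; apply/subkey_eqE; right; exact: subkey_child.
Qed.

Lemma down_closed_subkey N : down_closed (subkey N).
Proof. by move=> M L; exact: subkey_trans. Qed.

Lemma down_closed_subkey_eq N : down_closed (subkey_eq N).
Proof. by move=> M L; exact: subkey_eq_trans. Qed.

Lemma down_closedU D D' : down_closed D -> down_closed D' ->
  down_closed (fun M => D M \/ D' M).
Proof. by move=> dD dD' N M [/dD H|/dD' H] /H; [left|right]. Qed.

(* [cert D d r]: the defining relations of the nodes in [D] bound the norm of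
   the positive element [d] by [r]. *)
Inductive cert D : term R (key R * nat) -> R -> Prop :=
| cert0 : cert D tzero 0
| cert_leaf r j : D (leaf r) -> cert D (tabs (tvar (leaf r, j))) 1
| cert_node p g i b : D (node p g i) ->
    cert D (tabs (tmap (pair (node p g i)) b)) (p b)
| cert_glue p g i k : D (node p g i) ->
    cert D (tabs (tsub (tvar (node p g i, k.*2)) (tvar (g k, i k)))) 0
| cert_add d d' r r' : cert D d r -> cert D d' r' -> cert D (tadd d d') (r + r')
| cert_scale a d r : 0 <= a -> cert D d r -> cert D (tscale a d) (a * r).

Definition norm_le D u r := exists d r', [/\ cert D d r', tle (tabs u) d & r' <=
  r].

Definition norm_le_eps D u r := forall e, 0 < e -> norm_le D u (r + e).

(** Gluing does not shrink the earlier norm as long as [p] dominates it on the glued points. The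
    norm is taken over strict subkeys, so the condition refers to nothing at or above the node. *)
Definition contractive N : Prop :=
  if N is node p g i then forall w : term R nat,
    norm_le_eps (subkey N) (tmap (fun k => (g k, i k)) w) (p (tmap double w))
  else True.

Definition good N := forall M, subkey_eq N M -> contractive M.

(** Phrased through values, as it is used: coordinates of a node outside [D] may be overridden at
    will. *)
Definition depends_on D u := forall x y : key R * nat -> R,
  (forall N j, D N -> x (N, j) = y (N, j)) -> val x u = val y u.

Lemma down_closed_good : down_closed good.
Proof. by move=> N M gN NM L ML; apply: gN; exact: subkey_eq_trans ML. Qed.

Lemma depends_on_var D N j : D N -> depends_on D (tvar (N, j)).
Proof. by move=> DN x y; exact. Qed.

Lemma depends_on_bind D A (f : A -> term R (key R * nat)) w :
  (forall a, depends_on D (f a)) -> depends_on D (tbind f w).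
Proof.
move=> fD x y xy; rewrite !val_tbind.
by congr val; apply/funext => a; exact: fD.
Qed.

Lemma depends_on_sub D D' u :
  (forall N, D N -> D' N) -> depends_on D u -> depends_on D' u.
Proof. by move=> DD' Du x y xy; apply: Du => N j /DD'; exact: xy. Qed.

Lemma cert_sub D D' d r : (forall N, D N -> D' N) -> cert D d r -> cert D' d r.
Proof.
move=> DD'; elim.
- exact: cert0.
- by move=> ? ? /DD'; exact: cert_leaf.
- by move=> ? ? ? ? /DD'; exact: cert_node.
- by move=> ? ? ? ? /DD'; exact: cert_glue.
- by move=> *; exact: cert_add.
- by move=> *; exact: cert_scale.
Qed.

Lemma cert_ge0 D d r : cert D d r -> (forall x, 0 <= val x d) /\ 0 <= r.
Proof.
elim=> [|r' j _|p g i b _|p g i k _|d1 d2 r1 r2 _ [H1 ?] _ [H2 ?]|a d1 r1 a0 _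
  [H1 ?]].
- by split.
- by split=> // x; rewrite val_tabs.
- by split=> [x|]; rewrite ?val_tabs//; apply: solid_ge0; exact: seminorm_solid.
- by split=> // x; rewrite val_tabs.
- by split=> [x|] /=; rewrite addr_ge0.
- by split=> [x|] /=; rewrite mulr_ge0.
Qed.

Lemma cert_depends_on D d r : down_closed D -> cert D d r -> depends_on D d.
Proof.
move=> dcD; elim=> [|r' j Dr|p g i b DN|p g i k DN|d1 d2 r1 r2 _ H1 _ H2|a d1 r1
  _ _ H1] x y xy.
- by [].
- by rewrite !val_tabs /= xy.
- rewrite !val_tabs !val_tmap; congr `|val _ _|; apply/funext => j.
  by rewrite /= xy.
- rewrite !val_tabs !val_tsub /= !xy//; apply: dcD DN _; apply/subkey_eqE.
  by right; exact: subkey_child.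
- by rewrite /= (H1 x y)// (H2 x y).
- by rewrite /= (H1 x y).
Qed.

Lemma cert_finite D d r : cert D d r ->
  exists2 L, (forall N, List.In N L -> D N) & cert (fun N => List.In N L) d r.
Proof.
elim=> [|r' j Dr|p g i b DN|p g i k DN|d1 d2 r1 r2 _ [L1 LD1 H1] _ [L2 LD2 H2]|a
  d1 r1 a0 _ [L LD H1]].
- by exists [::] => //; exact: cert0.
- by exists [:: leaf r'] => [N [<-|]//|]; apply: cert_leaf; left.
- by exists [:: node p g i] => [N [<-|]//|]; apply: cert_node; left.
- by exists [:: node p g i] => [N [<-|]//|]; apply: cert_glue; left.
- exists (L1 ++ L2) => [N|].
    by rewrite List.in_app_iff => -[/LD1|/LD2].
  by apply: cert_add; [move: H1|move: H2]; apply: cert_sub => N NL;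
    rewrite List.in_app_iff; [left|right].
- by exists L => //; exact: cert_scale.
Qed.

(** The relations of the top node merge into one use of [p] and one multiple of the gaps. A single
    [n] is both the number of gaps and their weight, which is the shape that [interpolation]
    takes. *)
Lemma cert_top_node D p g i d r :
  cert (fun M => D M \/ M = node p g i) d r ->
  exists d0 r0 (b : term R nat) n, [/\ cert D d0 r0, r0 + p b <= r &
    forall x, val x d <= val x d0 + `|val (fun j => x (node p g i, j)) b| +
      n%:R * \sum_(k < n) `|x (node p g i, k.*2) - x (g k, i k)|].
Proof.
set N := node p g i.
have nogap (x : key R * nat -> R) :
    0%:R * \sum_(k < 0) `|x (N, k.*2) - x (g k, i k)| = 0 by rewrite mul0r.
have sp := seminorm_solid p.
elim=> [|r' j DN|p' g' i' b DN|p' g' i' k DN|d1 d2 r1 r2 _ H1 _ H2|a d1 r1 a0 _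
  H1].
- exists tzero, 0, tzero, 0%N; split=> [||x]; first exact: cert0.
    by rewrite solid0// addr0.
  by rewrite nogap /= normr0 !addr0.
- exists (tabs (tvar (leaf r', j))), 1, tzero, 0%N; split=> [||x].
  + by apply: cert_leaf; case: DN.
  + by rewrite solid0// addr0.
  + by rewrite nogap val_tabs /= normr0 !addr0.
- case: DN => [DN|[-> -> ->]].
    exists (tabs (tmap (pair (node p' g' i')) b)), (p' b), tzero, 0%N.
    split=> [||x]; first exact: cert_node.
      by rewrite solid0// addr0.
    by rewrite nogap /= normr0 !addr0.
  exists tzero, 0, b, 0%N; split=> [||x]; first exact: cert0.
    by rewrite add0r.
  by rewrite nogap val_tabs val_tmap /= add0r addr0.
- case: DN => [DN|[-> -> ->]].
    exists (tabs (tsub (tvar (node p' g' i', k.*2)) (tvar (g' k, i' k)))), 0.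
    exists tzero, 0%N; split=> [||x]; first exact: cert_glue.
      by rewrite solid0// addr0.
    by rewrite nogap /= normr0 !addr0.
  exists tzero, 0, tzero, k.+1; split=> [||x]; first exact: cert0.
    by rewrite solid0// addr0.
  rewrite val_tabs val_tsub /= normr0 !add0r big_ord_recr/=.
  rewrite mulrDr -[X in X <= _]add0r lerD ?mulr_ge0 ?sumr_ge0//.
  by rewrite ler_peMl// ler1n.
- have [d1' [r1' [b1 [n1 [c1 r1P d1P]]]]] := H1.
  have [d2' [r2' [b2 [n2 [c2 r2P d2P]]]]] := H2.
  (* Absolute values prevent cancellation between [b1] and [b2]. *)
  exists (tadd d1' d2'), (r1' + r2'), (tadd (tabs b1) (tabs b2)), (n1 + n2)%N.
  split=> [||x]; first exact: cert_add.
    have := solidD sp (tabs b1) (tabs b2); rewrite !solid_tabs//; lra.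
  apply: le_trans (lerD (d1P x) (d2P x)) _.
  have -> : val x (tadd d1' d2') = val x d1' + val x d2' by [].
  have mono (m n : nat) (f : nat -> R) : (forall k, 0 <= f k) ->
      m%:R * \sum_(k < m) f k <= m%:R * \sum_(k < m + n) f k.
    move=> f0; rewrite ler_wpM2l// big_split_ord/= lerDl sumr_ge0//.
  have := mono n1 n2 (fun k => `|x (N, k.*2) - x (g k, i k)|).
  have := mono n2 n1 (fun k => `|x (N, k.*2) - x (g k, i k)|).
  rewrite [(n2 + n1)%N]addnC natrD mulrDl => /(_ _)/wrap[]// ? /(_ _)/wrap[]//
    ?.
  have -> : val (fun j => x (N, j)) (tadd (tabs b1) (tabs b2)) =
      `|val (fun j => x (N, j)) b1| + `|val (fun j => x (N, j)) b2|.
    by rewrite -!val_tabs.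
  rewrite [`|_ + _|]ger0_norm ?addr_ge0//; lra.
- have [d1' [r1' [b1 [n1 [c1 r1P d1P]]]]] := H1.
  pose n := (n1 * (Num.truncn a).+1)%N.
  exists (tscale a d1'), (a * r1'), (tscale a b1), n; split=> [||x].
  + exact: cert_scale.
  + by rewrite solidZ// ger0_norm// -mulrDr ler_wpM2l.
  + rewrite /= normrM [`|a|]ger0_norm//.
    apply: le_trans (ler_wpM2l a0 (d1P x)) _; rewrite !mulrDr lerD2l mulrA.
    have an : a * n1%:R <= n%:R.
      by rewrite /n natrM mulrC ler_wpM2l// ltW// truncnS_gt.
    apply: (@le_trans _ _ (n%:R * \sum_(k < n1) `|x (N, k.*2) - x (g k, i k)|)).
      by rewrite ler_wpM2r ?sumr_ge0.
    rewrite ler_wpM2l//.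
    have /subnKC <- : (n1 <= n)%N by rewrite leq_pmulr.
    by rewrite big_split_ord/= lerDl sumr_ge0.
Qed.

Lemma cert_top_leaf D a d r : cert (fun M => D M \/ M = leaf a) d r ->
  exists d0 r0, [/\ cert D d0 r0, r0 <= r &
    forall x, (forall j, x (leaf a, j) = 0) -> val x d <= val x d0].
Proof.
elim=> [|r' j DN|p' g' i' b DN|p' g' i' k DN|d1 d2 r1 r2 _ H1 _ H2|c d1 r1 c0 _
  H1].
- by exists tzero, 0; split=> //; exact: cert0.
- case: DN => [DN|[->]].
    by exists (tabs (tvar (leaf r', j))), 1; split=> //; exact: cert_leaf.
  exists tzero, 0; split=> // [|x x0]; first exact: cert0.
  by rewrite val_tabs /= x0 normr0.
- case: DN => // DN; exists (tabs (tmap (pair (node p' g' i')) b)), (p' b).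
  by split=> //; exact: cert_node.
- case: DN => // DN.
  exists (tabs (tsub (tvar (node p' g' i', k.*2)) (tvar (g' k, i' k)))), 0.
  by split=> //; exact: cert_glue.
- have [d1' [r1' [c1 r1P d1P]]] := H1; have [d2' [r2' [c2 r2P d2P]]] := H2.
  exists (tadd d1' d2'), (r1' + r2'); split=> [||x x0]; first exact: cert_add.
    exact: lerD.
  by rewrite /= lerD ?d1P ?d2P.
- have [d1' [r1' [c1 r1P d1P]]] := H1.
  exists (tscale c d1'), (c * r1'); split=> [||x x0]; first exact: cert_scale.
    exact: ler_wpM2l.
  by rewrite /= ler_wpM2l ?d1P.
Qed.

Lemma norm_le_sub D D' u r :
  (forall N, D N -> D' N) -> norm_le D u r -> norm_le D' u r.
Proof.
move=> DD' [d [r' [c ud r'r]]]; exists d, r'; split=> //.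
exact: cert_sub c.
Qed.

Lemma norm_le_le D u r r' : r <= r' -> norm_le D u r -> norm_le D u r'.
Proof.
move=> rr' [d [t [c ud tr]]]; exists d, t; split=> //; exact: le_trans rr'.
Qed.

Definition override (x : key R * nat -> R) N (y : nat -> R) :=
  fun a => if pselect (a.1 = N) then y a.2 else x a.

Lemma override_same x N y j : override x N y (N, j) = y j.
Proof. by rewrite /override; case: pselect. Qed.

Lemma override_neq x N y M j : M <> N -> override x N y (M, j) = x (M, j).
Proof. by rewrite /override; case: pselect. Qed.

Lemma val_override x N y D u : depends_on D u -> ~ D N ->
  val (override x N y) u = val x u.
Proof.
move=> Du DN; apply: Du => M j DM; rewrite override_neq// => MN.
by rewrite MN in DM.
Qed.

(** Neither [u] nor the part [d0] of the combination reads the coordinates of the node, so the bound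
    on [|u| - d0] holds for every choice [y] of them. Interpolation replaces the infimum over [y] by
    a term [w] in the glued points, and contractivity bounds the norm of [w] below the node by means
    of [p]. *)
Lemma norm_le_top_node D p g i u r : down_closed D -> ~ D (node p g i) ->
  (forall k, D (g k)) -> contractive (node p g i) -> depends_on D u ->
  norm_le (fun M => D M \/ M = node p g i) u r -> norm_le_eps D u r.
Proof.
set N := node p g i => dcD DN Dg cN Du [d [r' [c ud r'r]]] e e0.
have [d0 [r0 [b [n [c0 r0P dP]]]]] := cert_top_node c.
have sp := seminorm_solid p.
pose m := \sum_(k < n) p (tvar k.*2).
have m0 : 0 <= m by apply: sumr_ge0 => k _; exact: solid_ge0.
(* Measured by [p], the interpolation error is at most [e / 2]; the other half of [e] goes into
   contractivity. *)
have e'0 : 0 < e / 2 / (m + 1) by rewrite !divr_gt0//; lra.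
have me : e / 2 / (m + 1) * m <= e / 2.
  by rewrite -mulrA ger_pMr ?divr_gt0// mulrC ler_pdivrMr; lra.
have [|w [w0 wl wu]] := @interpolation R nat (tabs b) double n _ e'0.
  by move=> y; rewrite val_tabs.
have pw : p (tmap double w) <= p b + e / 2.
  pose t := tscale (e / 2 / (m + 1)) (tsum n (fun k => tabs (tvar k.*2))).
  apply: (@le_trans _ _ (p (tadd (tabs b) t))).
    apply: solid_abs_le => // y; rewrite val_tmap ger0_norm//.
    apply: le_trans (wu y) _; rewrite [leRHS]/= -/(val y (tabs b)) lerD2l valE.
    by under [X in _ <= _ * X]eq_bigr do rewrite val_tabs.
  apply: le_trans (solidD sp _ _) _; rewrite solid_tabs// lerD2l.
  rewrite /t solidZ// gtr0_norm// (le_trans _ me)// ler_pM2l//.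
  apply: le_trans (solid_tsum sp _ _) _; apply: ler_sum => k _.
  by rewrite solid_tabs.
have e20 : 0 < e / 2 by rewrite divr_gt0.
have [d1 [r1 [c1 wd1 r1P]]] := cN w _ e20.
exists (tadd d0 d1), (r0 + r1); split.
- apply: cert_add => //; apply: cert_sub c1 => M [k]; exact: dcD.
- move=> x; have -> : val x (tadd d0 d1) = val x d0 + val x d1 by [].
  rewrite -lerBlDl; apply: le_trans (wd1 x).
  rewrite [leRHS]val_tabs val_tmap; apply: le_trans (ler_norm _).
  apply: wl => y; rewrite lerBlDl !val_tabs.
  have := le_trans (ud (override x N y)) (dP (override x N y)).
  have Du' : depends_on D (tabs u).
    by move=> x1 x2 xx; rewrite !val_tabs (Du x1 x2).
  rewrite (val_override _ _ Du' DN) (val_override _ _ (cert_depends_on dcD c0)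
    DN).
  have -> : (fun j => override x N y (N, j)) = y.
    by apply/funext => j; rewrite override_same.
  rewrite val_tabs -addrA.
  rewrite (eq_bigr (fun k : 'I_n => `|y k.*2 - x (g k, i k)|)); first by [].
  move=> k _; rewrite override_same override_neq// => gN.
  by apply: DN; rewrite -gN.
- lra.
Qed.

Definition conservative N := forall D u r, down_closed D -> depends_on D u ->
  norm_le (fun M => D M \/ subkey_eq N M) u r -> norm_le_eps D u r.

Lemma conservative_seq L D u r : down_closed D -> depends_on D u ->
  (forall M, List.In M L -> D M \/ exists2 N, conservative N & subkey_eq N M) ->
  norm_le (fun M => D M \/ List.In M L) u r -> norm_le_eps D u r.
Proof.
elim: L => [|M L IH] in D r *; move=> dcD Du LP H e e0.
  apply: norm_le_le (norm_le_sub _ H); first by rewrite lerDl ltW.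
  by move=> N [].
have [DM|[N cN NM]] := LP M (or_introl erefl).
  apply: (IH D r) => // [N LN|]; first by apply: LP; right.
  by apply: norm_le_sub H => N [|[<-|]]; [left|left|right].
have e20 : 0 < e / 2 by rewrite divr_gt0.
(* The base must remain closed downwards, so all of [subkey_eq N] is added to it while the tail of
   the list is discarded; conservativity of [N] then removes the addition. *)
have : norm_le_eps (fun M => D M \/ subkey_eq N M) u r.
  apply: IH.
  - by apply: down_closedU => //; exact: down_closed_subkey_eq.
  - by apply: depends_on_sub Du; left.
  - by move=> M' LM'; have [|] := LP M' (or_intror LM'); [left; left|right].
  - by apply: norm_le_sub H => M' [|[<-|]]; [left; left|left; right|right].
move=> /(_ _ e20)/cN -/(_ dcD Du _ e20).
by rewrite -addrA -splitr.
Qed.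

Lemma norm_le_finite D u r : norm_le D u r -> exists2 L,
  (forall N, List.In N L -> D N) & norm_le (fun N => List.In N L) u r.
Proof.
by move=> [d [r' [/cert_finite[L LD c] ud r'r]]]; exists L => //; exists d, r'.
Qed.

(* The norm of an element does not depend on the nodes above it: such nodes
   are discarded from the top. *)
Lemma good_conservative N : good N -> conservative N.
Proof.
elim: N => [a|p g IH i] gN D u r dcD Du.
  move=> /= H; have [DN|DN] := pselect (D (leaf a)).
    move=> e e0; apply: norm_le_le (norm_le_sub _ H);
      first by rewrite lerDl ltW.
    by move=> M [|[->|]].
  have [d [r' [c ud r'r]]] : norm_le (fun M => D M \/ M = leaf a) u r.
    by apply: norm_le_sub H => M [|[->|]]; [left|right|].
  have [d0 [r0 [c0 r0r' dP]]] := cert_top_leaf c.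
  move=> e e0; exists d0, r0; split=> //; last lra.
  (* A leaf is discarded by setting its coordinates to 0, where its relations contribute nothing. *)
  move=> x; pose x' := override x (leaf a) (fun=> 0).
  have Du' : depends_on D (tabs u).
    by move=> x1 x2 xx; rewrite !val_tabs (Du x1 x2).
  rewrite -(val_override x (fun=> 0) Du' DN).
  rewrite -(val_override x (fun=> 0) (cert_depends_on dcD c0) DN).
  apply: le_trans (ud _) (dP _ _) => j.
  by rewrite override_same.
move=> H; have [DN|DN] := pselect (D (node p g i)).
  move=> e e0; apply: norm_le_le (norm_le_sub _ H); first by rewrite lerDl ltW.
  by move=> M [//|]; exact: dcD.
(* The node itself goes first, over a base that keeps everything below it; what lies below is then
   removed by induction on the children. *)
pose D1 M := D M \/ subkey (node p g i) M.
have dcD1 : down_closed D1 by apply: down_closedU => //;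
  exact: down_closed_subkey.
have Du1 : depends_on D1 u by apply: depends_on_sub Du; left.
have H1 : norm_le_eps D1 u r.
  apply: (norm_le_top_node dcD1 _ _ (gN _ (subkey_eq_refl _)) Du1).
  - by case=> //; exact: subkey_irrefl.
  - by move=> k; right; exact: subkey_child.
  - apply: norm_le_sub H => M [|/subkey_eqE[|]]; first by left; left.
      by right.
    by left; right.
move=> e e0; have e20 : 0 < e / 2 by rewrite divr_gt0.
(* There are infinitely many children, but a combination of relations meets only finitely many
   keys. *)
have [L LD1 HL] := norm_le_finite (H1 _ e20).
have : norm_le_eps D u (r + e / 2).
  apply: (@conservative_seq L) => //; last first.
    by apply: norm_le_sub HL => M; right.
  move=> M /LD1[|[k kM]]; first by left.
  right; exists (g k) => //; apply: IH => M' gM'; apply: gN.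
  by right; exists k.
by move=> /(_ _ e20); rewrite -addrA -splitr.
Qed.

Lemma norm_le_conservative D D' u r : down_closed D ->
  (forall N, D' N -> good N) -> depends_on D u ->
  norm_le D' u r -> norm_le_eps D u r.
Proof.
move=> dcD gD' Du /norm_le_finite[L LD' HL].
apply: (@conservative_seq L) => //; last by apply: norm_le_sub HL; right.
move=> M /LD'/gD' gM; right; exists M; last exact: subkey_eq_refl.
exact: good_conservative.
Qed.

End Certificates.

(** * The universal norm: extensions, completeness, separated points *)

Section UniversalNorm.
Variable R : realType.

Lemma norm_leD (D : key R -> Prop) u v r s :
  norm_le D u r -> norm_le D v s -> norm_le D (tadd u v) (r + s).
Proof.
move=> [d [r' [c ud r'r]]] [d' [s' [c' vd s's]]].
exists (tadd d d'), (r' + s'); split; [exact: cert_add| |exact: lerD].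
move=> x; rewrite val_tabs /=; apply: le_trans (ler_normD _ _) _.
by rewrite -!val_tabs lerD.
Qed.

Lemma norm_leZ (D : key R -> Prop) a u r :
  norm_le D u r -> norm_le D (tscale a u) (`|a| * r).
Proof.
move=> [d [r' [c ud r'r]]].
exists (tscale `|a| d), (`|a| * r'); split;
  [exact: cert_scale| |exact: ler_wpM2l].
by move=> x; rewrite val_tabs /= normrM ler_wpM2l// -val_tabs.
Qed.

Lemma norm_le_mono (D : key R -> Prop) u v r :
  tle (tabs u) (tabs v) -> norm_le D v r -> norm_le D u r.
Proof.
move=> uv [d [r' [c vd r'r]]]; exists d, r'; split=> // x.
exact: le_trans (uv x) (vd x).
Qed.

Lemma norm_le_ge0 (D : key R -> Prop) u r : norm_le D u r -> 0 <= r.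
Proof. by move=> [d [r' [/cert_ge0[_ ?] _]]]; exact: le_trans. Qed.

Lemma norm_le_cert (D : key R -> Prop) d r : cert D d r -> norm_le D d r.
Proof.
move=> c; exists d, r; split=> // x.
by rewrite val_tabs ger0_norm//; have [] := cert_ge0 c.
Qed.

Lemma norm_le_tsum (D : key R -> Prop) n f r :
  (forall k, norm_le D (f k) (r k)) -> norm_le D (tsum n f) (\sum_(k < n) r k).
Proof.
move=> H; elim: n => [|n IHn] /=; rewrite ?big_ord0 ?big_ord_recr/=.
  by apply: norm_le_cert; exact: cert0.
exact: norm_leD.
Qed.

Definition good_point := {a : key R * nat | good a.1}.

Definition gnorm (u : term R good_point) :=
  inf [set r | norm_le (@good R) (tmap sval u) r].

Lemma norm_le_exists (u : term R good_point) :
  exists r, norm_le (@good R) (tmap sval u) r.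
Proof.
elim: u => [[[[a|p g i] j] gN]||u [r H] v [s H']|a u [r H]|u [r H] v [s H']].
- exists 1; apply: (@norm_le_mono _ _ (tabs (tvar (leaf a, j)))).
    by move=> x; rewrite !val_tabs normr_id.
  by apply: norm_le_cert; exact: cert_leaf.
- exists (p (tvar j)); apply: (@norm_le_mono _ _ (tabs (tmap (pair (node p g i))
    (tvar j)))).
    by move=> x; rewrite !val_tabs normr_id.
  by apply: norm_le_cert; exact: cert_node.
- by exists 0; apply: norm_le_cert; exact: cert0.
- by exists (r + s); exact: norm_leD.
- by exists (`|a| * r); exact: norm_leZ.
- exists (r + s); move: H H' => [d [r' [c ud r'r]]] [d' [s' [c' vd s's]]].
  exists (tadd d d'), (r' + s'); split; [exact: cert_add| |exact: lerD].
  move=> x; rewrite val_tabs /=.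
  have := distr_max (val x (tmap sval u)) (val x (tmap sval v)) 0 0.
  rewrite maxxx !subr0 => /le_trans; apply.
  by rewrite lerD// -val_tabs.
Qed.

Lemma gnorm_le u r : norm_le (@good R) (tmap sval u) r -> gnorm u <= r.
Proof.
by move=> H; apply: ge_inf => //; exists 0 => s /norm_le_ge0.
Qed.

Lemma gnorm_ge u r :
  (forall s, norm_le (@good R) (tmap sval u) s -> r <= s) -> r <= gnorm u.
Proof. by move=> H; apply: lb_le_inf => //; exact: norm_le_exists. Qed.

Lemma norm_le_gnorm u : norm_le_eps (@good R) (tmap sval u) (gnorm u).
Proof.
move=> e e0.
have H : has_inf [set r | norm_le (@good R) (tmap sval u) r].
  split; first exact: norm_le_exists.
  by exists 0 => s /norm_le_ge0.
have [s us /ltW s_le] := inf_adherent e0 H.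
exact: norm_le_le us.
Qed.

Lemma gnorm_solid : solid gnorm.
Proof.
split=> [u v|r u|u v uv].
- apply/ler_addgt0Pr => e e0; have e20 : 0 < e / 2 by rewrite divr_gt0.
  apply: le_trans (@gnorm_le (tadd u v) _ (norm_leD (norm_le_gnorm u e20)
    (norm_le_gnorm v e20))) _.
  lra.
- apply/ler_addgt0Pr => e e0; have e'0 : 0 < e / (`|r| + 1).
    by rewrite divr_gt0// ltr_wpDl.
  apply: le_trans (@gnorm_le (tscale r u) _ (norm_leZ r (norm_le_gnorm u e'0)))
    _.
  rewrite mulrDr lerD2l mulrCA ger_pMr// ler_pdivrMr ?ltr_wpDl//.
  by rewrite mul1r lerDl.
- apply: gnorm_ge => s vs; apply: gnorm_le; apply: norm_le_mono vs => x.
  by have := uv (x \o sval); rewrite !val_tabs !val_tmap.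
Qed.

(** The hypothesis measures with all good nodes, [contractive] with strict subkeys only;
    conservativity bridges the two. *)
Lemma adjoin_good (p : seminorm R) (t : nat -> good_point) :
  (forall w, gnorm (tmap t w) <= p (tmap double w)) ->
  good (node p (fun k => (sval (t k)).1) (fun k => (sval (t k)).2)).
Proof.
move=> tp M [->|[k kM]]; last by have := svalP (t k); apply.
move=> w e e0; set N := node _ _ _.
have e20 : 0 < e / 2 by rewrite divr_gt0.
have H : norm_le (@good R) (tmap (fun k => sval (t k)) w) (p (tmap double w) + e
  / 2).
  have -> : tmap (fun k => sval (t k)) w = tmap sval (tmap t w).
    by rewrite tmap_comp.
  by apply: norm_le_le (norm_le_gnorm _ e20); rewrite lerD2r.
have := @norm_le_conservative _ (subkey N) (@good R) _ _ (@down_closed_subkey _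
  N)
  (fun _ => id) _ H _ e20.
rewrite -addrA -splitr (_ : (fun k => _) = (fun k => sval (t k))).
  apply; apply: depends_on_bind => k;
    rewrite /= (surjective_pairing (sval (t k))).
  by apply: depends_on_var; exact: subkey_child.
by apply/funext => k; rewrite -surjective_pairing.
Qed.

(* Every separable extension of a separable part of the space is realized in
   the space itself. *)
Lemma adjoin (p : seminorm R) (t : nat -> good_point) :
  (forall w, gnorm (tmap t w) = p (tmap double w)) -> exists y : nat ->
    good_point,
  (forall b, gnorm (tmap y b) = p b) /\
  forall k, gnorm (tsub (tvar (y k.*2)) (tvar (t k))) = 0.
Proof.
move=> tp; set N := node p (fun k => (sval (t k)).1) (fun k => (sval (t k)).2).
have gN : good N by apply: adjoin_good => w; rewrite tp.
pose y j : good_point := exist _ (N, j) gN; exists y.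
have sp := seminorm_solid p.
split=> [b|k]; last first.
  apply/le_anti; rewrite (solid_ge0 gnorm_solid) andbT; apply: gnorm_le.
  apply: (norm_le_mono _ (norm_le_cert (@cert_glue _ _ p _ _ k gN))) => x.
  by rewrite !val_tabs normr_id !valE /= -surjective_pairing.
have yE : tmap sval (tmap y b) = tmap (pair N) b by rewrite tmap_comp.
apply/le_anti/andP; split.
  apply: gnorm_le; rewrite yE.
  apply: (norm_le_mono _ (norm_le_cert (@cert_node _ _ p _ _ b gN))) => x.
  by rewrite !val_tabs normr_id.
apply: gnorm_ge => r; rewrite yE => H.
apply/ler_addgt0Pr => e e0; have e20 : 0 < e / 2 by rewrite divr_gt0.
(* Discarding all keys not below [N] leaves [N] as the top node of the combination. *)
have /(_ _ e20) [d [r' [c bd r'r]]] : norm_le_eps (subkey_eq N) (tmap (pair N)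
  b) r.
  apply: (norm_le_conservative _ _ _ H) => //;
    first exact: down_closed_subkey_eq.
  by apply: depends_on_bind => k; apply: depends_on_var; exact: subkey_eq_refl.
have {}c : cert (fun M => subkey N M \/ M = N) d r'.
  by apply: cert_sub c => M /subkey_eqE[]; [right|left].
have [d0 [r0 [b' [n [c0 r0P dP]]]]] := cert_top_node c.
(* The [+ 1] is slack for the infimum [gnorm], which need not be attained. *)
pose m := \sum_(k < n) (gnorm (tvar (t k)) + 1).
have m0 : 0 <= m.
  by apply: sumr_ge0 => k _; rewrite addr_ge0// (solid_ge0 gnorm_solid).
have e'0 : 0 < e / 2 / (m + 1) by rewrite !divr_gt0//; lra.
have me : e / 2 / (m + 1) * m <= e / 2.
  by rewrite -mulrA ger_pMr ?divr_gt0// mulrC ler_pdivrMr; lra.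
have [d0_ge0 _] := cert_ge0 c0.
(* Here the roles are opposite to those in [norm_le_top_node]: the part [d0] below the node is
   replaced by a term in the glued points. Its norm there is carried back to [p] by [tp], now used
   as the bound of [p] by [gnorm]. *)
have [w [w0 wl wu]] := @interpolation R _ d0 (fun k => sval (t k)) n _ e'0
  d0_ge0.
have : p b <= p b' + p (tmap double w).
  rewrite -[p b']solid_tabs//; apply: le_trans (solidD sp _ _).
  apply: solid_abs_le => // z.
  have -> : val z (tadd (tabs b') (tmap double w)) =
    `|val z b'| + val (z \o double) w by rewrite -val_tabs -val_tmap.
  rewrite -lerBlDl; apply: wl => x; rewrite lerBlDl.
  have := le_trans (bd (override x N z)) (dP (override x N z)).
  rewrite (val_override _ _ (cert_depends_on (@down_closed_subkey _ N) c0)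
    (@subkey_irrefl _ N)).
  rewrite val_tabs val_tmap.
  have -> : override x N z \o pair N = z.
    by apply/funext => j; rewrite /= override_same.
  have -> : (fun j => override x N z (N, j)) = z.
    by apply/funext => j; rewrite override_same.
  rewrite [val x d0 + _]addrC -addrA.
  rewrite (eq_bigr (fun k : 'I_n => `|x (sval (t k)) - (z \o double) k|))//.
  move=> k _; rewrite override_same override_neq; last first.
    move=> tN; apply: (@subkey_irrefl _ N); rewrite -{2}tN.
    exact: (@subkey_child _ p (fun k => (sval (t k)).1)).
  by rewrite -surjective_pairing distrC.
have : p (tmap double w) <= r0 + e / 2.
  rewrite -tp; apply: gnorm_le; rewrite tmap_comp.
  apply: (@norm_le_le _ _ _ (r0 + `|e / 2 / (m + 1)| * m)).
    by rewrite lerD2l gtr0_norm.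
  pose f k : term R (key R * nat) := tabs (tvar (sval (t k))).
  apply: (@norm_le_mono _ _ (tadd d0 (tscale (e / 2 / (m + 1)) (tsum n f)))).
    move=> x; rewrite !val_tabs val_tmap ger0_norm//.
    apply: le_trans (wu x) _; apply: le_trans (ler_norm _).
    rewrite [leRHS]/= valE; apply: lerD => //; apply: ler_wpM2l;
      first exact: ltW.
    by apply: ler_sum => k _; rewrite /f val_tabs.
  apply: norm_leD.
    apply: norm_le_sub (norm_le_cert c0) => M NM.
    by apply: (down_closed_good gN); apply/subkey_eqE; right.
  apply: norm_leZ.
  apply: (@norm_le_tsum _ n f (fun k => gnorm (tvar (t k)) + 1)) => k.
  apply: norm_le_mono (norm_le_gnorm (tvar (t k)) ltr01) => x.
  by rewrite /f !val_tabs normr_id.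
lra.
Qed.

(** Writes a whole sequence of terms over one sequence of points, to which a single node can be
    glued. *)
Lemma term_seq_cover A (a0 : A) (u : nat -> term R A) : exists t : nat -> A,
  forall n, exists b, u n = tmap t b.
Proof.
pose fix vars (v : term R A) : seq A := match v with
  | tvar a => [:: a] | tzero => [::] | tadd v w | tjoin v w => vars v ++ vars w
  | tscale _ v => vars v end.
pose t k := if unpickle k is Some (n, j) then nth a0 (vars (u n)) j else a0.
exists t => n.
have H v : (exists l1 l2, vars (u n) = l1 ++ vars v ++ l2) ->
    exists b, v = tmap t b.
  elim: v => [a||v IHv w IHw|r v IHv|v IHv w IHw] /= [l1 [l2 E]].
  - exists (tvar (pickle (n, size l1))).
    by rewrite /tmap /= /t pickleK E nth_cat ltnn subnn.
  - by exists tzero.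
  - have [|b ->] := IHv; first by exists l1, (vars w ++ l2); rewrite E -catA.
    have [|c ->] := IHw; first by exists (l1 ++ vars v), l2; rewrite E -!catA.
    by exists (tadd b c).
  - have [|b ->] := IHv; first by exists l1, l2.
    by exists (tscale r b).
  - have [|b ->] := IHv; first by exists l1, (vars w ++ l2); rewrite E -catA.
    have [|c ->] := IHw; first by exists (l1 ++ vars v), l2; rewrite E -!catA.
    by exists (tjoin b c).
by apply: H; exists [::], [::]; rewrite cats0.
Qed.

Lemma good_leaf (r : R) : good (leaf r).
Proof. by move=> M [->|]. Qed.

(** Leaves provide continuum many separated points, for the lower bound on the density character. *)
Definition leaf_point (r : R) : good_point := exist _ (leaf r, 0%N) (@good_leaf
  r).

Lemma solid_lim A (c : nat -> term R A -> R) :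
  (forall m, solid (c m)) -> (forall b, cvgn (c ^~ b)) ->
  solid (fun b => limn (c ^~ b)).
Proof.
move=> sc cc; split=> [u v|r u|u v uv].
- rewrite -limD//; apply: ler_lim => //; first exact: is_cvgD.
  by apply: nearW => m; exact: solidD.
- have E : (fun m => `|r| * c m u) @ \oo --> `|r| * limn (c ^~ u).
    exact: (cvgM (cvg_cst _) (cc u)).
  rewrite -(cvg_lim _ E)//; apply: ler_lim => //; first exact: (cvgP _ E).
  by apply: nearW => m; exact: solidZ_le.
- by apply: ler_lim => //; apply: nearW => m; exact: solid_le.
Qed.

(* The limit of a Cauchy sequence is itself a point of a further node. *)
Lemma gnorm_complete (u : nat -> term R good_point) :
  (forall e, 0 < e -> exists n0, forall m n, (n0 <= m)%N -> (n0 <= n)%N ->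
    gnorm (tsub (u m) (u n)) <= e) ->
  exists y : good_point, forall e, 0 < e -> exists n0, forall n, (n0 <= n)%N ->
    gnorm (tsub (tvar y) (u n)) <= e.
Proof.
move=> uC; have sg := gnorm_solid.
have [t tP] := term_seq_cover (leaf_point 0) u.
have [b bP] := choice tP.
(* Even indices carry the variables of the sequence, as the gluing requires. Odd indices stand for
   the limit, which stage [m] approximates by [u m]. *)
pose s m k : term R good_point := if odd k then u m else tvar (t k./2).
pose c m v := gnorm (tbind (s m) v).
have sc m : solid (c m).
  split=> [v w|r v|v w vw]; first exact: (solidD sg).
    exact: (solidZ_le sg).
  apply: (solid_le sg) => x; have := vw (fun a => val x (s m a)).
  by rewrite !val_tabs !val_tbind.
have cC v e : 0 < e -> exists n0, forall m n, (n0 <= m)%N -> (n0 <= n)%N ->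
    `|c m v - c n v| <= e.
  move=> e0; have [C [k [C0 CP]]] := solid_tbind2 v.
  have d0 : 0 < C * k%:R + 1 by rewrite ltr_wpDl// mulr_ge0.
  have [n0 n0P] := uC (e / (C * k%:R + 1)) (divr_gt0 e0 d0).
  exists n0 => m n mn nn; apply: le_trans (solid_sub_le sg _ _) _.
  apply: le_trans (CP _ _ (s m) (s n) sg) _.
  apply: (@le_trans _ _ (C * (k%:R * (e / (C * k%:R + 1))))).
    rewrite ler_wpM2l// (_ : _%:R * _ = \sum_(j < k) e / (C * k%:R + 1)).
      rewrite ler_sum// => j _.
      rewrite /s; case: ifP => _; first exact: n0P.
      rewrite (solid_eq sg (v := tzero)) ?solid0//.
        by rewrite ltW ?divr_gt0.
      by move=> x; rewrite val_tsub subrr.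
    by rewrite sumr_const card_ord mulr_natl.
  by rewrite !mulrA ler_pdivrMr// mulrDr mulr1 mulrC lerDl ltW.
have cc v : cvgn (c ^~ v).
  apply: cauchy_cvg; apply: cauchy_exP => e e0.
  have [n0 n0P] := cC v (e / 2) (divr_gt0 e0 (ltr0Sn _ _)).
  exists (c n0 v); exists n0 => // n /= n0n.
  rewrite -ball_normE /=; apply: le_lt_trans (n0P _ _ _ _) _ => //.
  by rewrite ltr_pdivrMr// ltr_pMr// ltr1n.
pose p := Seminorm (solid_lim sc cc).
have pd w : gnorm (tmap t w) = p (tmap double w).
  rewrite /p /=; under eq_fun => m.
    rewrite /c tbind_tmap (_ : s m \o double = tvar \o t); last first.
      by apply/funext => k; rewrite /s /= odd_double doubleK.
    over.
  by rewrite lim_cst.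
have [y [yP yt]] := adjoin pd; exists (y 1%N) => e e0.
have [n0 n0P] := uC e e0; exists n0 => n n0n.
apply: le_trans (solid_tsub_trans sg (tmap (y \o double) (b n)) _ _) _.
rewrite [X in _ + X](_ : _ = 0) ?addr0; last first.
  apply/le_anti; rewrite (solid_ge0 sg) andbT bP.
  have [C [k [C0 CP]]] := solid_tbind2 (b n).
  apply: le_trans (CP _ _ (tvar \o (y \o double)) (tvar \o t) sg) _.
  by rewrite big1 ?mulr0// => j _; exact: yt.
(* Both points now lie in the new node, so [p] gives their distance: the limit over [m] of that from
   [u m] to [u n]. *)
have -> : tsub (tvar (y 1%N)) (tmap (y \o double) (b n)) =
    tmap y (tsub (tvar 1%N) (tmap double (b n))).
  by rewrite /tsub /topp /tmap /= tbind_tmap.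
have sb m : tbind (s m) (tmap double (b n)) = u n.
  rewrite tbind_tmap bP /tmap; congr tbind.
  by apply/funext => k; rewrite /s /= odd_double doubleK.
rewrite yP; apply: limr_le => //; exists n0 => // m /= n0m.
have -> : c m (tsub (tvar 1%N) (tmap double (b n))) = gnorm (tsub (u m) (u n)).
  by rewrite -(sb m).
exact: n0P.
Qed.

(** By conservativity only relations of leaves matter. Evaluation at the indicator of the leaf [r]
    respects all of these and gives the difference the value 1. *)
Lemma leaf_point_dist r s : r != s ->
  1 <= gnorm (tsub (tvar (leaf_point r)) (tvar (leaf_point s))).
Proof.
move=> rs; apply: gnorm_ge => c H; apply/ler_addgt0Pr => e e0.
pose D (N : key R) := exists a, N = leaf a.
have /(_ _ e0) [d [c' [cd ud c'c]]] : norm_le_eps D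
    (tmap sval (tsub (tvar (leaf_point r)) (tvar (leaf_point s)))) c.
  apply: norm_le_conservative H => //.
    by move=> N M [a ->] [->|//]; exists a.
  by move=> x y xy; rewrite !val_tmap !val_tsub /= !xy//; eexists.
pose x (a : key R * nat) : R := if pselect (a.1 = leaf r) then 1 else 0.
have dc : val x d <= c'.
  elim: cd => [|a j _|? ? ? ? [] //|? ? ? ? [] //|d1 d2 r1 r2 _ H1 _ H2|a d1 r1
    a0 _ H1].
  - by [].
  - by rewrite val_tabs /= /x; case: pselect => ?; rewrite ?normr0 ?normr1.
  - exact: lerD.
  - exact: ler_wpM2l.
apply: le_trans c'c; apply: le_trans dc; apply: le_trans (ud x).
rewrite val_tabs val_tmap val_tsub /= /x /=.
case: pselect => //= _; case: pselect => [sr|_] /=;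
  last by rewrite subr0 normr1.
by case: sr => sr; rewrite sr eqxx in rs.
Qed.

End UniversalNorm.
(** * Banach lattices from seminorms *)

Record complete_seminorm (R : realType) (A : Type) := CompleteSeminorm {
  complete_seminorm_fun :> term R A -> R ;
  complete_seminorm_solid : solid complete_seminorm_fun ;
  complete_seminorm_cvg : forall u : nat -> term R A,
    (forall e, 0 < e -> exists n0, forall m n, (n0 <= m)%N -> (n0 <= n)%N ->
      complete_seminorm_fun (tsub (u m) (u n)) <= e) ->
    exists v, forall e, 0 < e -> exists n0, forall n, (n0 <= n)%N ->
      complete_seminorm_fun (tsub v (u n)) <= e }.

Section Quotient.
Variables (R : realType) (A : Type) (p : complete_seminorm R A).
Implicit Types u v w : term R A.

Let sp : solid p := complete_seminorm_solid p.

Lemma solid_eq0 u v : (forall x, `|val x u| <= `|val x v|) -> p v = 0 -> p u =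
  0.
Proof.
move=> uv v0; apply/le_anti; rewrite (solid_ge0 sp) andbT -v0.
by apply: (solid_le sp) => x; rewrite !val_tabs.
Qed.

(** Null terms form an ideal; this reduces laws of the quotient to inequalities between real
    numbers. *)
Lemma solid_eq0D u v w : (forall x, `|val x u| <= `|val x v| + `|val x w|) ->
  p v = 0 -> p w = 0 -> p u = 0.
Proof.
move=> uvw v0 w0; apply/le_anti; rewrite (solid_ge0 sp) andbT.
apply: (@le_trans _ _ (p (tadd (tabs v) (tabs w)))).
  by apply: (solid_abs_le sp) => x; apply: le_trans (uvw x) _;
    rewrite -!val_tabs.
by apply: le_trans (solidD sp _ _) _; rewrite !(solid_tabs sp) v0 w0 addr0.
Qed.

Definition equivalent u : set (term R A) := [set v | p (tsub u v) = 0].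

Definition quot : Type := {C : set (term R A) | exists u, C = equivalent u}.

Definition qpi u : quot := exist _ (equivalent u) (ex_intro _ u erefl).

Definition qrepr (x : quot) : term R A := sval (cid (svalP x)).

Lemma quot_eq (x y : quot) : sval x = sval y -> x = y.
Proof. by case: x y => [C HC] [D HD] /= CD; exact: eq_exist. Qed.

Lemma qreprK x : qpi (qrepr x) = x.
Proof. by apply: quot_eq; rewrite /qrepr; case: cid. Qed.

Lemma solid_eq0_trans v u w :
  p (tsub u v) = 0 -> p (tsub v w) = 0 -> p (tsub u w) = 0.
Proof.
move=> uv vw; apply: solid_eq0D uv vw => x.
by rewrite !val_tsub (le_trans _ (ler_normD _ _))// addrA subrK.
Qed.

Lemma qpi_eq u v : p (tsub u v) = 0 -> qpi u = qpi v.
Proof.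
move=> uv; apply: quot_eq; apply/funext => w; apply/propext; split.
  by apply: solid_eq0_trans; rewrite (solid_tsubC sp).
exact: solid_eq0_trans.
Qed.

Lemma qpi_repr u : p (tsub (qrepr (qpi u)) u) = 0.
Proof.
have : equivalent (qrepr (qpi u)) = equivalent u.
  by have := congr1 sval (qreprK (qpi u)).
move=> /(congr1 (fun C : set _ => C u)); rewrite /equivalent /= => ->.
by rewrite (solid_eq sp (v := tzero)) ?solid0// => x; rewrite val_tsub subrr.
Qed.

Lemma qpi_val u v : (forall x, val x u = val x v) -> qpi u = qpi v.
Proof.
move=> uv; apply: qpi_eq; rewrite (solid_eq sp (v := tzero)) ?solid0// => x.
by rewrite val_tsub uv subrr.
Qed.

Lemma quot_ind (P : quot -> Prop) : (forall u, P (qpi u)) -> forall x, P x.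
Proof. by move=> H x; rewrite -(qreprK x). Qed.

HB.instance Definition _ := gen_eqMixin quot.
HB.instance Definition _ := gen_choiceMixin quot.

Definition qzero := qpi tzero.
Definition qadd (x y : quot) := qpi (tadd (qrepr x) (qrepr y)).
Definition qopp (x : quot) := qpi (topp (qrepr x)).
Definition qscale (r : R) (x : quot) := qpi (tscale r (qrepr x)).
Definition qjoin (x y : quot) := qpi (tjoin (qrepr x) (qrepr y)).
Definition qmeet (x y : quot) := qpi (tmeet (qrepr x) (qrepr y)).
Definition qnorm (x : quot) := p (qrepr x).
Definition qle : rel quot := fun x y =>
  `[< p (tjoin (tsub (qrepr x) (qrepr y)) tzero) = 0 >].

Lemma qaddE u v : qadd (qpi u) (qpi v) = qpi (tadd u v).
Proof.
apply: qpi_eq; apply: solid_eq0D (qpi_repr u) (qpi_repr v) => x.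
by rewrite !val_tsub /= opprD addrACA ler_normD.
Qed.

Lemma qscaleE r u : qscale r (qpi u) = qpi (tscale r u).
Proof.
apply: qpi_eq; have := solid_tscale2 sp r (qrepr (qpi u)) u.
by rewrite qpi_repr mulr0.
Qed.

Lemma qoppE u : qopp (qpi u) = qpi (topp u).
Proof. exact: qscaleE. Qed.

Lemma qjoinE u v : qjoin (qpi u) (qpi v) = qpi (tjoin u v).
Proof.
apply: qpi_eq; apply: solid_eq0D (qpi_repr u) (qpi_repr v) => x.
rewrite !val_tsub; exact: distr_max.
Qed.

Lemma qmeetE u v : qmeet (qpi u) (qpi v) = qpi (tmeet u v).
Proof. by rewrite /qmeet /tmeet -!qoppE -!qjoinE -!qoppE !qreprK. Qed.

Lemma qnormE u : qnorm (qpi u) = p u.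
Proof.
apply/eqP; rewrite -subr_eq0 -normr_le0 -(qpi_repr u).
exact: solid_sub_le.
Qed.

Lemma qleP u v : reflect (p (tjoin (tsub u v) tzero) = 0) (qle (qpi u) (qpi v)).
Proof.
have H a b c d : p (tsub a c) = 0 -> p (tsub b d) = 0 ->
    p (tjoin (tsub a b) tzero) = 0 -> p (tjoin (tsub c d) tzero) = 0.
  move=> ac bd ab; have := solid_eq0D _ ac bd.
  move=> /(_ (tadd (tabs (tsub a c)) (tabs (tsub b d)))) => /(_ _)/wrap[x|acbd].
    rewrite [X in `|X| <= _](_ : _ = `|val x (tsub a c)| + `|val x (tsub b d)|).
      by rewrite ger0_norm.
    by rewrite -!val_tabs.
  apply: solid_eq0D acbd ab => x.
  rewrite (_ : val x (tadd _ _) = `|val x a - val x c| + `|val x b - val x d|).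
    rewrite /= !mulN1r ger0_norm; last by rewrite le_max lexx orbT.
    rewrite [`|_ + _|]ger0_norm ?addr_ge0// [X in _ <= _ + X]ger0_norm;
      last first.
      by rewrite le_max lexx orbT.
    have := ler_norm (val x a - val x c); have := ler_norm (val x b - val x d).
    have := ler_norm (val x c - val x a); have := ler_norm (val x d - val x b).
    rewrite [`|val x c - _|]distrC [`|val x d - _|]distrC.
    have := normr_ge0 (val x a - val x c);
      have := normr_ge0 (val x b - val x d).
    move=> ? ? ? ? ? ?.
    by case: (leP (val x c - _) _) => ?; case: (leP (val x a - _) _) => ?; lra.
  by rewrite -!val_tsub -!val_tabs.
apply: (iffP idP) => [/asboolP|uv].
  by apply: H; exact: qpi_repr.
by apply/asboolP; apply: H uv; rewrite (solid_tsubC sp) qpi_repr.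
Qed.

Lemma qleW u v : (forall x, val x u <= val x v) -> qle (qpi u) (qpi v).
Proof.
move=> uv; apply/qleP; rewrite -(solid0 sp); apply: (solid_eq sp) => x.
have := uv x; rewrite -subr_le0 -val_tsub => uv0.
by rewrite /= -/(val x (tsub u v)); apply/max_idPr.
Qed.

Lemma qaddA : associative qadd.
Proof.
elim/quot_ind=> u; elim/quot_ind=> v; elim/quot_ind=> w.
by rewrite !qaddE; apply: qpi_val => x /=; rewrite addrA.
Qed.

Lemma qaddC : commutative qadd.
Proof.
elim/quot_ind=> u; elim/quot_ind=> v.
by rewrite !qaddE; apply: qpi_val => x /=; rewrite addrC.
Qed.

Lemma qadd0 : left_id qzero qadd.
Proof.
by elim/quot_ind=> u; rewrite !qaddE; apply: qpi_val => x /=; rewrite add0r.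
Qed.

Lemma qaddN : left_inverse qzero qopp qadd.
Proof.
elim/quot_ind=> u; rewrite qoppE qaddE; apply: qpi_val => x /=.
by rewrite mulN1r addNr.
Qed.

HB.instance Definition _ := GRing.isZmodule.Build quot qaddA qaddC qadd0 qaddN.

Lemma qscaleA (a b : R) x : qscale a (qscale b x) = qscale (a * b) x.
Proof.
elim/quot_ind: x => u; rewrite !qscaleE; apply: qpi_val => x /=.
by rewrite mulrA.
Qed.

Lemma qscale1 : left_id 1 qscale.
Proof.
by elim/quot_ind=> u; rewrite qscaleE; apply: qpi_val => x /=; rewrite mul1r.
Qed.

Lemma qscaleDr : right_distributive qscale +%R.
Proof.
move=> a; elim/quot_ind=> u; elim/quot_ind=> v.
rewrite -![_ + _]/(qadd _ _) qaddE !qscaleE qaddE; apply: qpi_val => x /=.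
by rewrite mulrDr.
Qed.

Lemma qscaleDl x : {morph qscale^~ x : a b / a + b}.
Proof.
move=> a b; elim/quot_ind: x => u.
rewrite -![_ + qscale _ _]/(qadd _ _) !qscaleE qaddE; apply: qpi_val => x /=.
by rewrite mulrDl.
Qed.

HB.instance Definition _ :=
  GRing.Zmodule_isLmodule.Build R quot qscaleA qscale1 qscaleDr qscaleDl.

Lemma qnormD (x y : quot) : qnorm (x + y) <= qnorm x + qnorm y.
Proof.
elim/quot_ind: x => u; elim/quot_ind: y => v.
rewrite -[_ + _ in leLHS]/(qadd _ _) qaddE !qnormE; exact: solidD.
Qed.

Lemma qnormZ (a : R) (x : quot) : qnorm (a *: x) = `|a| * qnorm x.
Proof.
elim/quot_ind: x => u; rewrite -[_ *: _]/(qscale _ _) qscaleE !qnormE.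
exact: solidZ.
Qed.

Lemma qnorm_eq0 (x : quot) : qnorm x = 0 -> x = 0.
Proof.
elim/quot_ind: x => u; rewrite qnormE => u0; apply: qpi_eq.
by apply: solid_eq0 u0 => x; rewrite val_tsub /= subr0.
Qed.

HB.instance Definition _ := Lmodule_isNormed.Build R quot qnormD qnormZ
  qnorm_eq0.

Lemma quot_normE u : `|qpi u| = p u.
Proof. exact: qnormE. Qed.

Lemma qpiD u v : qpi u + qpi v = qpi (tadd u v).
Proof. exact: qaddE. Qed.

Lemma qpiN u : - qpi u = qpi (topp u).
Proof. exact: qoppE. Qed.

Lemma qpiB u v : qpi u - qpi v = qpi (tsub u v).
Proof. by rewrite qpiN qpiD. Qed.

Lemma qpiZ (a : R) u : a *: qpi u = qpi (tscale a u).
Proof. exact: qscaleE. Qed.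

Lemma quot_cauchy_cvg (F : set_system quot) : ProperFilter F -> cauchy F -> cvg
  F.
Proof.
move=> FF FC.
(* Centres of shrinking balls of the filter form a Cauchy sequence, to which the sequential
   completeness of [p] applies. *)
have bx n : exists x : quot, F (ball x (2^-1 ^+ n)).
  by apply: ((cauchyP F).1 FC); rewrite exprn_gt0.
have [x xP] := choice bx.
have geo (e : R) : 0 < e -> exists n0, forall n, (n0 <= n)%N -> 2^-1 ^+ n < e :>
  R.
  move=> e0; have : (fun n => (2^-1 : R) ^+ n) @ \oo --> (0 : R).
    by apply: cvg_expr; rewrite ger0_norm// invf_lt1// ltr1n.
  move=> /cvgrPdist_lt/(_ _ e0)[n0 _ H]; exists n0 => n /H /=.
  by rewrite sub0r normrN ger0_norm.
have d m n : `|x m - x n| < 2^-1 ^+ m + 2^-1 ^+ n.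
  have [y [/= ym yn]] := filter_ex (filterI (xP m) (xP n)).
  move: ym yn; rewrite -!ball_normE /= => ym yn.
  rewrite -[x m](subrK y) -addrA; apply: le_lt_trans (ler_normD _ _) _.
  by rewrite ltrD// distrC.
have [e e0|v vP] := complete_seminorm_cvg (c := p) (u := qrepr \o x).
  have [n0 n0P] := geo (e / 2) (divr_gt0 e0 (ltr0Sn _ _)).
  exists n0 => m n /n0P mP /n0P nP.
  by rewrite -quot_normE -qpiB !qreprK; have := d m n; lra.
apply/cvg_ex; exists (qpi v); apply/cvgrPdist_lt => e e0.
have e30 : 0 < e / 3 by rewrite divr_gt0.
have [n0 n0P] := geo _ e30; have [n1 n1P] := vP _ e30.
set n := maxn n0 n1; have := n0P n (leq_maxl _ _); have := n1P n (leq_maxr _ _).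
rewrite -quot_normE -qpiB qreprK => vn ne.
apply: filterS (xP n) => y; rewrite -ball_normE /= => xy.
rewrite -[qpi v](subrK (x n)) -addrA; apply: le_lt_trans (ler_normD _ _) _; lra.
Qed.

HB.instance Definition _ := Uniform_isComplete.Build quot quot_cauchy_cvg.

Lemma val_tpos x u v :
  val x (tjoin (tsub u v) tzero) = Num.max (val x u - val x v) 0.
Proof. by rewrite /= mulN1r. Qed.

Lemma qle_refl : reflexive qle.
Proof. by elim/quot_ind=> u; exact: qleW. Qed.

Lemma qle_anti : antisymmetric qle.
Proof.
elim/quot_ind=> u; elim/quot_ind=> v => /andP[/qleP uv /qleP vu].
apply: qpi_eq; apply: solid_eq0D uv vu => x.
rewrite /= !mulN1r ler_norml.
have := ler_norm (Num.max (val x u - val x v) 0).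
have := ler_norm (Num.max (val x v - val x u) 0).
by case: (leP (val x u - val x v) 0) => ?;
  case: (leP (val x v - val x u) 0) => ?;
  rewrite ?normr0 => ? ?; lra.
Qed.

Lemma qle_trans : transitive qle.
Proof.
elim/quot_ind=> v; elim/quot_ind=> u; elim/quot_ind=> w => /qleP uv /qleP vw.
apply/qleP; apply: solid_eq0D uv vw => x /=.
rewrite !mulN1r !ger0_norm ?le_max ?lexx ?orbT//.
by case: (leP (val x u - val x w) 0) => ?;
  case: (leP (val x u - val x v) 0) => ?;
  case: (leP (val x v - val x w) 0) => ?; lra.
Qed.

Lemma qlexI x y z : qle x (qmeet y z) = qle x y && qle x z.
Proof.
elim/quot_ind: x => u; elim/quot_ind: y => v; elim/quot_ind: z => w.
rewrite qmeetE; apply/idP/andP => [uvw|[/qleP uv /qleP uw]].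
  by split; apply: qle_trans uvw _; apply: qleW => x;
    rewrite val_tmeet ge_min lexx ?orbT.
apply/qleP; apply: solid_eq0D uv uw => x.
rewrite !val_tpos val_tmeet !ger0_norm ?le_max ?lexx ?orbT//.
case: (leP (val x v)) => ?; case: (leP (val x u - _) 0) => ?;
  by case: (leP (val x u - val x v) 0) => ?;
    case: (leP (val x u - val x w) 0) => ?; lra.
Qed.

Lemma qleUx x y z : qle (qjoin x y) z = qle x z && qle y z.
Proof.
elim/quot_ind: x => u; elim/quot_ind: y => v; elim/quot_ind: z => w.
rewrite qjoinE; apply/idP/andP => [uvw|[/qleP uw /qleP vw]].
  by split; apply: qle_trans uvw; apply: qleW => x; rewrite le_max lexx ?orbT.
apply/qleP; apply: solid_eq0D uw vw => x.
rewrite !val_tpos !ger0_norm ?le_max ?lexx ?orbT// [val x (tjoin u v)]/=.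
case: (leP (val x u)) => ?; case: (leP (_ - val x w) 0) => ?;
  by case: (leP (val x u - val x w) 0) => ?;
    case: (leP (val x v - val x w) 0) => ?; lra.
Qed.

Lemma qleD2r z x y : qle x y -> qle (x + z) (y + z).
Proof.
elim/quot_ind: x => u; elim/quot_ind: y => v; elim/quot_ind: z => w /qleP uv.
rewrite !qpiD; apply/qleP; apply: solid_eq0 uv => x.
by rewrite !val_tpos /= opprD addrACA subrr addr0.
Qed.

Lemma qscale_ge0 (a : R) (x : quot) : 0 <= a -> qle 0 x -> qle 0 (a *: x).
Proof.
move=> a0; elim/quot_ind: x => u /qleP u0.
rewrite qpiZ; apply/qleP; rewrite -(mulr0 `|a|) -u0 -(solidZ sp).
apply: (solid_eq sp) => x; rewrite val_tpos.
by rewrite /= mulN1r !sub0r maxr_pMr// mulr0 mulrN.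
Qed.

HB.instance Definition _ := Lmodule_isVectorLattice.Build R quot
  qle_refl qle_anti qle_trans qlexI qleUx qleD2r qscale_ge0.

Lemma qpi_join u v : vjoin (qpi u) (qpi v) = qpi (tjoin u v).
Proof. exact: qjoinE. Qed.

Lemma quot_norm_le (x y : quot) : vle (modulus x) (modulus y) -> `|x| <= `|y|.
Proof.
elim/quot_ind: x => u; elim/quot_ind: y => v.
rewrite /modulus !qpiN !qpi_join => /qleP uv.
rewrite !quot_normE -(solid_tabs sp u) -(solid_tabs sp v).
rewrite -[leRHS]addr0 -uv; apply: le_trans (solidD sp _ _).
apply: (solid_abs_le sp) => x.
have -> : val x (tadd (tabs v) (tjoin (tsub (tabs u) (tabs v)) tzero)) =
    `|val x v| + Num.max (`|val x u| - `|val x v|) 0.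
  by rewrite -!val_tabs -val_tpos.
rewrite val_tabs normr_id.
by case: (leP (`|val x u| - _) 0) => ?; lra.
Qed.

HB.instance Definition _ :=
  NormedModule_isBanachLattice.Build R quot quot_norm_le.

(** The interface through which the quotient is used from here on; classes and representatives stay
    hidden behind it. *)
Record is_quotient (X : banachLatticeType R) (pi : term R A -> X) : Prop :=
  IsQuotient {
    quotient_surj : forall x, exists u, x = pi u ;
    quotient_dist : forall u v, `|pi u - pi v| = p (tsub u v) ;
    quotient_eval : forall (f : nat -> term R A) b,
      eval (pi \o f) b = pi (tbind f b) }.

Lemma quotient_exists : exists X : banachLatticeType R,
  exists pi : term R A -> X, is_quotient pi.
Proof.
exists quot, qpi; split=> [x|u v|f].
- by exists (qrepr x); rewrite qreprK.
- by rewrite qpiB quot_normE.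
elim=> //= [b -> c ->|r b ->|b -> c ->].
- exact: qpiD.
- exact: qpiZ.
- exact: qpi_join.
Qed.

End Quotient.
(** * Cardinality *)

Section Cardinality.
Variable R : realType.

Lemma injective_card_le T U (A : set T) (B : set U) (f : T -> U) :
  (forall x, A x -> B (f x)) -> {in A &, injective f} -> A #<= B.
Proof.
move=> fB /inj_card_eq/card_eqPle[_ /card_le_trans]; apply.
by apply: subset_card_le => _ [x Ax <-]; exact: fB.
Qed.

(* Base 3 expansions with digits 0 and 1. *)
Lemma card_bool_seq_le : exists f : (nat -> bool) -> R, injective f.
Proof.
pose s (b : nat -> bool) n : R := \sum_(k < n) (b k)%:R * 3^-1 ^+ k.
(* The added summand is the full tail of the geometric series. After a first difference at [n] the
   remaining tail is half of [3^-1 ^+ n], too small to make up for that digit. *)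
pose U b n := s b n + 3 / 2 * 3^-1 ^+ n.
have p0 n : 0 < 3^-1 ^+ n :> R by rewrite exprn_gt0// invr_gt0.
have sS b n : s b n.+1 = s b n + (b n)%:R * 3^-1 ^+ n by rewrite /s
  big_ord_recr.
have s_le b m n : s b m <= s b (m + n)%N.
  elim: n => [|n IH]; rewrite ?addn0// addnS sS (le_trans IH)// lerDl.
  by rewrite mulr_ge0// ltW.
have U_ge b m n : U b (m + n)%N <= U b m.
  elim: n => [|n IH]; rewrite ?addn0// addnS (le_trans _ IH)// /U sS exprS.
  by have := p0 (m + n)%N; case: (b _) => /= ?; lra.
have sU b m n : s b m <= U b n.
  have [mn|nm] := leqP m n.
    rewrite -(subnKC mn) (le_trans (s_le b m (n - m)%N))//.
    by rewrite lerDl mulr_ge0// ltW.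
  rewrite -(subnKC (ltnW nm)); apply: le_trans (U_ge b n (m - n)%N).
  by rewrite lerDl mulr_ge0// ltW.
pose f b := sup [set s b n | n in setT].
have f_ge b n : s b n <= f b.
  apply: ub_le_sup; last by exists n.
  by exists (U b 0%N) => _ [m _ <-].
have f_le b n : f b <= U b n.
  by apply: ge_sup => [|_ [m _ <-]//]; exists (s b 0%N), 0%N.
have main (b b' : nat -> bool) n : (forall k, (k < n)%N -> b k = b' k) -> b n ->
  ~~ b' n ->
    f b' < f b.
  move=> bb' bn b'n; apply: le_lt_trans (f_le b' n.+1) _.
  apply: lt_le_trans (f_ge b n.+1); rewrite /U !sS bn (negbTE b'n) exprS.
  have -> : s b' n = s b n by apply: eq_bigr => k _; rewrite bb'.
  by have := p0 n => /= ?; lra.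
exists f => b b' fbb'; apply/funext => n.
elim/ltn_ind: n => n IH; apply/idP/idP => bn; apply/negPn/negP => b'n.
  by have := main b b' n IH bn b'n; rewrite fbb' ltxx.
by have := main b' b n (fun k kn => esym (IH k kn)) bn b'n; rewrite fbb' ltxx.
Qed.

(** A sequence is coded by the rational cuts of its entries, one bit for each index and rational. *)
Lemma card_real_seq_le : exists f : (nat -> R) -> R, injective f.
Proof.
have [f f_inj] := card_bool_seq_le.
pose g (x : nat -> R) n :=
  if unpickle n is Some (k, q) then ratr (q : rat) < x (k : nat) else false.
exists (f \o g) => x y /f_inj gxy; apply/funext => k.
have H q : (ratr q < x k) = (ratr q < y k).
  by have := congr1 (@^~ (pickle (k, q))) gxy; rewrite /g pickleK.
apply/eqP; rewrite eq_le; apply/andP; split; rewrite leNgt; apply/negP => lt.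
  have [q] := rat_in_itvoo lt; rewrite in_itv/= => /andP[yq qx].
  by move: qx; rewrite H ltNge (ltW yq).
have [q] := rat_in_itvoo lt; rewrite in_itv/= => /andP[xq qy].
by move: qy; rewrite -H ltNge (ltW xq).
Qed.

(* Generic trees are countable, hence so are the terms they encode. *)
Fixpoint rational_term (t : GenTree.tree (nat + rat)) : term R nat :=
  match t with
  | GenTree.Leaf (inl k) => tvar k
  | GenTree.Node 0 [:: a; b] => tadd (rational_term a) (rational_term b)
  | GenTree.Node 1 [:: GenTree.Leaf (inr q); b] =>
      tscale (ratr q) (rational_term b)
  | GenTree.Node 2 [:: a; b] => tjoin (rational_term a) (rational_term b)
  | _ => tzero
  end.

(** The error is relative to a term [M] chosen before [e], so every solid seminorm makes it small,
    and its values on countably many terms determine it. *)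
Lemma rational_term_dense (u : term R nat) : exists M, forall e, 0 < e -> e <= 1
  ->
  exists t, forall x, `|val x u - val x (rational_term t)| <= e * val x M.
Proof.
elim: u => [k||u [M1 H1] v [M2 H2]|r u [M1 H1]|u [M1 H1] v [M2 H2]].
- exists tzero => e e0 _; exists (GenTree.Leaf (inl k)) => x.
  by rewrite subrr normr0 mulr0.
(* The label 3 falls under the default case of [rational_term], which is [tzero]. *)
- exists tzero => e e0 _; exists (GenTree.Node 3 [::]) => x.
  by rewrite subrr normr0 mulr0.
- exists (tadd M1 M2) => e e0 e1; have [t1 t1P] := H1 e e0 e1.
  have [t2 t2P] := H2 e e0 e1; exists (GenTree.Node 0 [:: t1; t2]) => x /=.
  by rewrite opprD addrACA mulrDr (le_trans (ler_normD _ _))// lerD.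
- exists (tadd (tscale `|r| M1) (tadd (tabs u) M1)) => e e0 e1.
  have [t tP] := H1 e e0 e1.
  have /rat_in_itvoo[q] : r < r + e by rewrite ltrDl.
  rewrite in_itv/= => /andP[rq qr].
  exists (GenTree.Node 1 [:: GenTree.Leaf (inr q); t]) => x.
  rewrite /= mulN1r maxrN.
  have := tP x => {}tP.
  set v := val x (rational_term t) in tP *; set a := val x u in tP *.
  have -> : r * a - ratr q * v = r * (a - v) + (r - ratr q) * v by ring.
  apply: le_trans (ler_normD _ _) _; rewrite !normrM.
  have M0 : 0 <= val x M1.
    by rewrite -(pmulr_rge0 _ e0); apply: le_trans tP.
  have h1 : `|r| * `|a - v| <= `|r| * (e * val x M1) by rewrite ler_wpM2l.
  have h2 : `|r - ratr q| <= e by rewrite distrC ger0_norm; lra.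
  have h3 : `|v| <= `|a| + val x M1.
    rewrite -[v](subrK a) addrC (le_trans (ler_normD _ _))// lerD2l distrC.
    by rewrite (le_trans tP)// ler_piMl.
  have h4 : `|r - ratr q| * `|v| <= e * (`|a| + val x M1).
    by apply: ler_pM => //; exact: normr_ge0.
  lra.
- exists (tadd M1 M2) => e e0 e1; have [t1 t1P] := H1 e e0 e1.
  have [t2 t2P] := H2 e e0 e1; exists (GenTree.Node 2 [:: t1; t2]) => x /=.
  by rewrite mulrDr (le_trans (distr_max _ _ _ _))// lerD.
Qed.

Lemma seminorm_eq (p q : seminorm R) :
  (forall t, p (rational_term t) = q (rational_term t)) -> p = q.
Proof.
move=> pq; have E : seminorm_fun p = seminorm_fun q.
  apply/funext => u; have [M MP] := rational_term_dense u.
  apply/eqP; rewrite -subr_eq0 -normr_le0; apply/ler_addgt0Pr => e e0.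
  rewrite add0r; have sp := seminorm_solid p; have sq := seminorm_solid q.
  have pq0 : 0 <= p M + q M by rewrite addr_ge0 ?(solid_ge0 sp) ?(solid_ge0 sq).
  have d0 : 0 < Num.min 1 (e / (p M + q M + 1)).
    by rewrite lt_min ltr01 divr_gt0// ltr_wpDl.
  have [|t tP] := MP _ d0; first by rewrite ge_min lexx.
  set d := Num.min _ _ in d0 tP.
  have H (s : seminorm R) : `|s u - s (rational_term t)| <= d * s M.
    apply: le_trans (solid_sub_le (seminorm_solid s) _ _) _.
    rewrite -[d]gtr0_norm// -(solidZ (seminorm_solid s)).
    by apply: (solid_abs_le (seminorm_solid s)) => x; rewrite val_tsub.
  rewrite -[p u](subrK (p (rational_term t))) -addrA {2}pq.
  apply: le_trans (ler_normD _ _) _; rewrite [X in _ + X]distrC.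
  apply: le_trans (lerD (H p) (H q)) _; rewrite -mulrDr.
  apply: (@le_trans _ _ (e / (p M + q M + 1) * (p M + q M))).
    by rewrite ler_wpM2r// ge_min lexx orbT.
  by rewrite mulrAC ler_pdivrMr ?ltr_wpDl// ler_pM2l// lerDl.
by case: p q E {pq} => [f sf] [g sg] /= fg; move: sf sg; rewrite fg => sf sg;
  rewrite (Prop_irrelevance sf sg).
Qed.

(* A key is determined by the labels at the end of all its finite paths. *)
Fixpoint key_labels (N : key R) (l : seq nat) (n : nat) : R :=
  match N, l with
  | leaf r, _ => if n is 0 then 0 else r
  | node p g i, [::] => if n is m.+1 then
      match unpickle m : option (nat + GenTree.tree (nat + rat)) with
      | Some (inl k) => (i k)%:R
      | Some (inr t) => p (rational_term t)
      | None => 0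
      end else 1
  | node p g i, k :: l => key_labels (g k) l n
  end.

(** On the empty path, index 0 separates leaves from nodes, and later indices give the real of a
    leaf, or [i] and the values of [p] on rational terms. Longer paths recover the children. *)
Lemma key_labels_inj : injective key_labels.
Proof.
elim=> [r|p g IH i] [s|q h j] E.
- by have := congr1 (fun F => F [::] 1%N) E => /= ->.
- by have := congr1 (fun F => F [::] 0%N) E => /= /esym/eqP; rewrite oner_eq0.
- by have := congr1 (fun F => F [::] 0%N) E => /= /eqP; rewrite oner_eq0.
have -> : i = j.
  apply/funext => k; apply/eqP; rewrite -(eqr_nat R); apply/eqP.
  have := congr1 (fun F => F [::] (pickle (inl k : nat + GenTree.tree (nat +
    rat))).+1) E.
  by rewrite /= pickleK.
have -> : p = q.
  apply: seminorm_eq => t.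
  have := congr1 (fun F => F [::] (pickle (inr t : nat + GenTree.tree (nat +
    rat))).+1) E.
  by rewrite /= pickleK.
congr node; apply/funext => k; apply: IH; apply/funext => l.
exact: (congr1 (fun F => F (k :: l)) E).
Qed.

Lemma card_point_le : exists f : good_point R -> R, injective f.
Proof.
have [f f_inj] := card_real_seq_le.
pose F (y : good_point R) n : R :=
  match unpickle n : option (option (seq nat * nat)) with
  | Some (Some (l, m)) => key_labels (sval y).1 l m
  | _ => (sval y).2%:R end.
exists (f \o F) => -[[N j] gN] [[M k] gM] /f_inj E.
have Ejk : j = k.
  apply/eqP; rewrite -(eqr_nat R); apply/eqP.
  have := congr1 (@^~ (pickle (None : option (seq nat * nat)))) E.
  by rewrite /F pickleK.
have ENM : N = M.
  apply: key_labels_inj; apply/funext => l; apply/funext => m.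
  have := congr1 (@^~ (pickle (Some (l, m)))) E.
  by rewrite /F pickleK.
by apply: eq_exist; rewrite Ejk ENM.
Qed.

End Cardinality.
(** * Universal disposition *)

Section Embeddings.
Variable R : realType.

Lemma eval_tbind (E : vectorLatticeType R) A B (s : B -> E) (f : A -> term R B)
  u :
  eval s (tbind f u) = eval (fun a => eval s (f a)) u.
Proof. by elim: u => //= [u -> v ->|r u ->|u -> v ->]. Qed.

Lemma eval_tsub (E : vectorLatticeType R) A (s : A -> E) u v :
  eval s (tsub u v) = eval s u - eval s v.
Proof. by rewrite /= scaleN1r. Qed.

Lemma eval_tabs (E : vectorLatticeType R) A (s : A -> E) u :
  eval s (tabs u) = modulus (eval s u).
Proof. by rewrite /= scaleN1r. Qed.

Lemma eval_tmeet (E : vectorLatticeType R) A (s : A -> E) u v :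
  eval s (tmeet u v) = vmeet (eval s u) (eval s v).
Proof. by rewrite /= !scaleN1r vjoinN !opprK. Qed.

Section Norm.
Variable E : banachLatticeType R.

Lemma solid_norm_eval (s : nat -> E) : solid (fun u => `|eval s u|).
Proof.
split=> [u v|r u|u v uv] /=; first exact: ler_normD.
  by rewrite normrZ.
by apply: blat_norm_le; rewrite -!eval_tabs; exact: tle_eval.
Qed.

(** [solid_tbind2] compares two substitutions under one seminorm, hence the interleaving of [s] and
    [s'] into one sequence. *)
Lemma norm_eval_lipschitz (b : term R nat) : exists C : R, exists n, 0 <= C /\
  forall s s' : nat -> E,
    `|eval s b - eval s' b| <= C * \sum_(k < n) `|s k - s' k|.
Proof.
have [C [n [C0 CP]]] := solid_tbind2 b; exists C, n; split=> // s s'.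
pose t k := if odd k then s' k./2 else s k./2.
have := CP _ _ (fun k => tvar k.*2) (fun k => tvar k.*2.+1) (solid_norm_eval t).
rewrite eval_tsub !eval_tbind.
have -> : (fun k => eval t (tvar k.*2)) = s.
  by apply/funext => k; rewrite /= /t odd_double doubleK.
have -> : (fun k => eval t (tvar k.*2.+1)) = s'.
  by apply/funext => k; rewrite /= /t /= odd_double /= uphalf_double.
move=> /le_trans; apply; rewrite le_eqVlt; apply/orP; left; apply/eqP.
congr (_ * _); apply: eq_bigr => k _; rewrite eval_tsub /= /t /=.
by rewrite odd_double /= uphalf_double doubleK.
Qed.

End Norm.

Lemma eval_embedding (E F : banachLatticeType R) (f : E -> F) A (s : A -> E) u :
  lattice_embedding f -> eval (f \o s) u = f (eval s u).
Proof.
case=> fl _ _ fj; have f0 : f 0 = 0.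
  by have := fl (-1) 0 0; rewrite scaler0 addr0 scaleN1r addNr.
elim: u => //= [u -> v ->|r u ->|u -> v ->].
- by rewrite -[eval s u in RHS]scale1r fl scale1r.
- by rewrite -[r *: eval s u]addr0 fl f0 addr0.
- by rewrite fj.
Qed.

Lemma embedding_dist (E F : banachLatticeType R) (f : E -> F) x y :
  lattice_embedding f -> `|f x - f y| = `|x - y|.
Proof.
case=> fl fn _ _; rewrite -(fn (x - y)) addrC -[- f y]scaleN1r -fl scaleN1r.
by rewrite addrC.
Qed.

Lemma dense_norm (V : normedModType R) (D : set V) x (e : R) :
  dense D -> 0 < e -> exists y, D y /\ `|x - y| < e.
Proof.
move=> dD e0; have [||y [xy Dy]] := dD (ball x e); first by exists x;
  exact: ballxx.
  exact: ball_open.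
by exists y; split=> //; move: xy; rewrite -ball_normE.
Qed.

Lemma separable_dense_seq (S : banachLatticeType R) : separable S ->
  exists s : nat -> S, forall x e, 0 < e -> exists n, `|x - s n| < e.
Proof.
move=> [D dD /countable_injP[c cinj]].
pose s n := xget 0 [set x | D x /\ c x = n].
exists s => x e e0; have [y [Dy xy]] := dense_norm x dD e0.
exists (c y); rewrite (_ : s (c y) = y)//.
rewrite /s; case: xgetP => [z _ [Dz cz]|/(_ y)]; last by case.
by apply: cinj => //; rewrite inE.
Qed.

(** A metric subspace of a separable space is separable: for each [n] and [m] a point is picked
    whose image is within [m.+1%:R^-1] of [s n], if there is one. *)
Lemma embedding_dense_seq (E S : banachLatticeType R) (f : E -> S) :
  separable S -> lattice_embedding f ->
  exists s : nat -> E, forall x e, 0 < e -> exists n, `|x - s n| < e.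
Proof.
move=> /separable_dense_seq[s sP] fE.
pose t k := if unpickle k is Some (n, m)
  then xget 0 [set x | `|f x - s n| < m.+1%:R^-1] else 0.
exists t => x e e0; pose m := Num.truncn (e / 2)^-1.
have me : m.+1%:R^-1 <= e / 2.
  rewrite -[leRHS]invrK lef_pV2 ?posrE ?invr_gt0 ?divr_gt0//.
  by apply/ltW; exact: truncnS_gt.
have [n xn] : exists n, `|f x - s n| < m.+1%:R^-1.
  by apply: sP; rewrite invr_gt0.
exists (pickle (n, m)); rewrite /t pickleK.
case: xgetP => [y _ yn|/(_ x)]; last by case.
rewrite -(embedding_dist _ _ fE) -[f x](subrK (s n)) -addrA.
apply: le_lt_trans (ler_normD _ _) _; rewrite [X in _ + X]distrC.
by rewrite [ltRHS]splitr ltrD// (lt_le_trans _ me).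
Qed.

End Embeddings.

(** * The universal lattice: density character and extension of embeddings *)

Section UniversalLattice.
Variable R : realType.

Lemma gnorm_complete_term (u : nat -> term R (good_point R)) :
  (forall e, 0 < e -> exists n0, forall m n, (n0 <= m)%N -> (n0 <= n)%N ->
    gnorm (tsub (u m) (u n)) <= e) ->
  exists v, forall e, 0 < e -> exists n0, forall n, (n0 <= n)%N ->
    gnorm (tsub v (u n)) <= e.
Proof. by move=> /gnorm_complete[y yP]; exists (tvar y). Qed.

Definition universal_seminorm :=
  CompleteSeminorm (@gnorm_solid R) gnorm_complete_term.

Section Properties.
Variables (X : banachLatticeType R) (pi : term R (good_point R) -> X).
Variable piX : is_quotient universal_seminorm pi.

Let pi_dist u v : `|pi u - pi v| = gnorm (tsub u v).
Proof. exact: (quotient_dist piX). Qed.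

Let pi0 : pi tzero = 0.
Proof. exact: (esym (quotient_eval piX (fun=> tzero) tzero)). Qed.

(** Completeness supplies limits that are single generators, and a constant sequence of terms has
    such a limit too. *)
Lemma quotient_point x : exists y, x = pi (tvar y).
Proof.
have [u ->] := quotient_surj piX x;
  have [e e0|y yP] := @gnorm_complete R (fun=> u).
  exists 0%N => m n _ _; rewrite (solid_eq (@gnorm_solid R) (v := tzero)).
    by rewrite (solid0 (@gnorm_solid R)) ltW.
  by move=> x0; rewrite val_tsub subrr.
exists y; apply/esym/eqP; rewrite -subr_eq0 -normr_le0 pi_dist.
apply/ler_addgt0Pr => e e0.
by have [n0 H] := yP e e0; rewrite add0r; exact: (H n0).
Qed.

Lemma leaf_dist (r s : R) : r != s ->
  1 <= `|pi (tvar (leaf_point r)) - pi (tvar (leaf_point s))|.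
Proof. by move=> rs; rewrite pi_dist leaf_point_dist. Qed.

Lemma quotient_density : has_density_character X [set: R].
Proof.
split.
  (* The whole space already has no more than continuum many points. *)
  exists setT; first by move=> O [x Ox] _; exists x.
  apply/card_eqPle; split.
    have [f f_inj] := card_point_le R.
    have [t tP] := choice quotient_point.
    apply: (@injective_card_le _ _ _ _ (f \o t)) => // x y _ _ /f_inj txy.
    by rewrite (tP x) (tP y) txy.
  apply: (@injective_card_le _ _ _ _ (fun r => pi (tvar (leaf_point r)))) => //.
  move=> r s _ _ rs; apply/eqP/negPn/negP => /leaf_dist.
  by rewrite rs subrr normr0 ler10.
move=> D dD.
have near r : exists x, D x /\ `|pi (tvar (leaf_point r)) - x| < 2^-1.
  by apply: dense_norm => //; rewrite invr_gt0.
have [d dP] := choice near.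
apply: (@injective_card_le _ _ _ _ d) => [r _|r s _ _ rs];
  first exact: (dP r).1.
apply/eqP/negPn/negP => /leaf_dist.
have := (dP s).2; rewrite -rs => ds; rewrite leNgt => /negP; apply.
apply: le_lt_trans (ler_distD (d r) _ _) _; rewrite [ltRHS]splitr !div1r.
by rewrite ltrD ?(dP r).2// distrC.
Qed.

Lemma quotient_disposition :
  universal_disposition (fun S : banachLatticeType R => separable S) X.
Proof.
move=> E S f g sepS fE gE.
have [s0 s0P] := separable_dense_seq sepS.
have [e0 e0P] := embedding_dense_seq sepS fE.
(* Even points come from [E], since these are the ones a node glues to earlier points; odd points
   make the sequence dense in [S]. *)
pose s k : S := if odd k then s0 k./2 else f (e0 k./2).
pose p := Seminorm (solid_norm_eval s).
have [t tP] := choice (fun k => quotient_point (g (e0 k))).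
have pt w : gnorm (tmap t w) = p (tmap double w).
  rewrite /p /= /tmap eval_tbind.
  have -> : (fun k => eval s ((tvar \o double) k)) = f \o e0.
    by apply/funext => k; rewrite /= /s odd_double doubleK.
  rewrite (eval_embedding _ _ fE) (embedding_norm fE) -(embedding_norm gE).
  have -> : gnorm (tmap t w) = `|pi (tmap t w)|.
    rewrite -[pi _]subr0 -pi0 pi_dist; apply: (solid_eq (@gnorm_solid R)) => x.
    by rewrite val_tsub /= subr0.
  rewrite -(eval_embedding _ _ gE) -(quotient_eval piX).
  by congr `|eval _ _|; apply/funext => k /=; rewrite tP.
have [y [yp yt]] := adjoin pt.
pose J b := pi (tmap y b).
have JB b c : `|J b - J c| = `|eval s b - eval s c|.
  by rewrite pi_dist (_ : tsub _ _ = tmap y (tsub b c))// yp -eval_tsub.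
have Jeval (b : nat -> term R nat) c : eval (J \o b) c = J (tbind b c).
  rewrite (quotient_eval piX (fun k => tmap y (b k))) /J /tmap; congr pi.
  by elim: c => //= [u -> v ->|r u ->|u -> v ->].
have appr x e : 0 < e -> exists b, `|x - eval s b| < e.
  move=> /(s0P x)[n xn]; exists (tvar n.*2.+1).
  by rewrite /= /s /= odd_double /= uphalf_double.
(* The extension by continuity of [J] is specified through distances to all [J b], so no
   independence of the approximating sequence has to be checked. *)
have hP x : exists z : X, forall b, `|z - J b| = `|x - eval s b|.
  have xb n : exists b, `|x - eval s b| < n.+1%:R^-1 by apply: appr;
    rewrite invr_gt0.
  have [b bP] := choice xb.
  have small e : 0 < e -> exists n0, forall n, (n0 <= n)%N -> `|x - eval s (b
    n)| <= e.
    move=> e_gt0; exists (Num.truncn e^-1) => n n0n;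
      apply/ltW/(lt_le_trans (bP n)).
    rewrite -[leRHS]invrK lef_pV2 ?posrE ?invr_gt0//.
    by apply/ltW/(lt_le_trans (truncnS_gt _)); rewrite ler_nat.
  have [e e_gt0|v vP] := @gnorm_complete_term (fun n => tmap y (b n)).
    have [n0 n0P] := small (e / 2) (divr_gt0 e_gt0 (ltr0Sn _ _)).
    exists n0 => m n /n0P xm /n0P xn; rewrite -pi_dist JB.
    rewrite -[eval s (b m)](subrK x) -addrA.
    by apply: le_trans (ler_normD _ _) _; rewrite [`|_ - x|]distrC; lra.
  exists (pi v) => c; apply/eqP; rewrite -subr_eq0 -normr_le0.
  apply/ler_addgt0Pr => e e_gt0; rewrite add0r.
  have e20 : 0 < e / 2 by rewrite divr_gt0.
  have [n0 n0P] := small _ e20; have [n1 n1P] := vP _ e20.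
  set n := maxn n0 n1; have := n0P n (leq_maxl _ _);
    have := n1P n (leq_maxr _ _).
  rewrite -pi_dist -/(J _) => vn xn.
  rewrite -[`|pi v - _|](subrK `|J (b n) - J c|) {2}JB -addrA.
  apply: le_trans (ler_normD _ _) _.
  have := ler_dist_dist (pi v - J c) (J (b n) - J c).
  have := ler_dist_dist (eval s (b n) - eval s c) (x - eval s c).
  rewrite !opprB !addrA !subrK [`|eval s (b n) - x|]distrC; lra.
have [h hJ] := choice hP.
(* Commutation with all terms gives linearity and both lattice operations at once; it holds for [J]
   and passes to the limit by the Lipschitz bounds. *)
have heval (z : nat -> S) c : h (eval z c) = eval (h \o z) c.
  have [C [n [C0 CP]]] := norm_eval_lipschitz S c.
  have [C' [n' [C'0 CP']]] := norm_eval_lipschitz X c.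
  apply/eqP; rewrite -subr_eq0 -normr_le0; apply/ler_addgt0Pr => e e_gt0.
  rewrite add0r; pose M := C * n%:R + C' * n'%:R.
  have M0 : 0 <= M by rewrite addr_ge0// mulr_ge0.
  pose d := e / (M + 1).
  have d0 : 0 < d by rewrite divr_gt0// ltr_wpDl.
  have Md : M * d <= e.
    by rewrite /d mulrCA ger_pMr// ler_pdivrMr ?ltr_wpDl// mul1r lerDl.
  move: d d0 Md => d d0 Md.
  have [b bP] := choice (fun k => appr (z k) d d0).
  have sum_le m : \sum_(k < m) `|z k - eval s (b k)| <= m%:R * d.
    rewrite (_ : _ * d = \sum_(k < m) d);
      last by rewrite sumr_const card_ord mulr_natl.
    by apply: ler_sum => k _; exact/ltW/bP.
  rewrite -[h _](subrK (J (tbind b c))) -addrA (le_trans (ler_normD _ _))//.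
  rewrite hJ eval_tbind [X in _ + X]distrC -Jeval.
  have H1 := le_trans (CP z (fun k => eval s (b k))) (ler_wpM2l C0 (sum_le n)).
  have H2 : `|eval (h \o z) c - eval (J \o b) c| <= C' * (n'%:R * d).
    apply: le_trans (CP' _ _) (ler_wpM2l C'0 _); apply: le_trans (sum_le n').
    by apply: ler_sum => k _; rewrite /= hJ.
  apply: le_trans (lerD H1 H2) _; rewrite !mulrA -mulrDl; exact: Md.
pose pair (x1 x2 : S) k := if k is 0%N then x1 else x2.
exists h.
  split=> [a x1 x2|x|x1 x2|x1 x2].
  - exact: (heval (pair x1 x2) (tadd (tscale a (tvar 0%N)) (tvar 1%N))).
  - have := hJ x tzero; rewrite /= subr0 => <-.
    by rewrite (_ : J tzero = 0) ?subr0.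
  - by have := heval (pair x1 x2) (tmeet (tvar 0%N) (tvar 1%N));
      rewrite !eval_tmeet.
  - exact: (heval (pair x1 x2) (tjoin (tvar 0%N) (tvar 1%N))).
apply/funext => x /=; apply/eqP; rewrite -subr_eq0 -normr_le0.
apply/ler_addgt0Pr => e e_gt0; rewrite add0r.
have [k xk] := e0P x (e / 2) (divr_gt0 e_gt0 (ltr0Sn _ _)).
have Jk : J (tvar k.*2) = g (e0 k).
  apply/eqP; rewrite tP -subr_eq0 -normr_eq0 pi_dist.
  by apply/eqP; exact: yt.
rewrite -[h _](subrK (J (tvar k.*2))) -addrA (le_trans (ler_normD _ _))//.
rewrite hJ Jk (embedding_dist _ _ gE) /= /s odd_double doubleK.
by rewrite (embedding_dist _ _ fE) [`|e0 k - x|]distrC; lra.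
Qed.

End Properties.

End UniversalLattice.

Theorem theorem5p3 (R : realType) :
  exists X : banachLatticeType R,
    has_density_character X [set: R] /\
    universal_disposition (fun S : banachLatticeType R => separable S) X.
Proof.
have [X [pi piX]] := quotient_exists (universal_seminorm R).
by exists X; split; [exact: quotient_density piX|exact: quotient_disposition
  piX].
Qed.
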